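(* Let $\rho<1$ and $r>\rho$. Let $\Phi:\mathbb{R}^d\to\mathbb{R}$ be $\mathcal{C}^\infty$ and such that for all $\alpha\in\mathbb{N}^d$ there is $c_\alpha$ with $|\partial_x^\alpha\Phi(x)|\leq c_\alpha\langle x\rangle^{r-|\alpha|}$ for all $x\in\mathbb{R}^d$. Let $A=A_\Phi\in\mathcal{A}_r$ and, for all $K\in2\mathbb{N}^*$, let $A^K=A_{\Phi,K}$ be its spectral approximation. Let $t\mapsto B(t)$ be a continuous map from $\mathbb{R}$ to $\mathcal{A}_\rho$ with $B(t)^*=B(t)$, and let $t\mapsto B^\bullet(t)=\{B^K(t)\}_{K\in2\mathbb{N}^*}$ be a continuous map from $\mathbb{R}$ to $\mathcal{A}_\rho^{\rm per}$ such that $B^K(t)$ is Hermitian for all $K$ and all $t$. Assume that for all $\alpha\in\mathbb{Z}^d$, $N\in\mathbb{N}$ there exists $C_{\alpha,N,\rho}$ such that $$\forall t\in\mathbb{R},\quad \|B(t)\|_{\alpha,N,\rho}+\llbracket B^\bullet(t)\rrbracket_{\alpha,N,\rho}\leq C_{\alpha,N,\rho}.$$ Let $x(t)\in h^s$ and $x^K(t)\in\ell^2(\mathbb{Z}_K^d)$ be the solutions of the systems $$\dot x=iAx+iB(t)x\quad\text{and}\quad\dot x^K=iA^Kx^K+iB^K(t)x^K.$$ Then for all $s\geq0$ there exists a constant $C_{s,\rho}$ (independent of $t$ and $K$) such that $$\forall t\in\mathbb{R},\quad\|x(t)\|_s\leq C_{s,\rho}\langle t\rangle^{\frac{s}{1-\rho}}\|x(0)\|_s,$$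 $$\forall K\in2\mathbb{N}^*,\ \forall t\in\mathbb{R},\quad\|x^K(t)\|_{s,K}\leq C_{s,\rho}\langle t\rangle^{\frac{s}{1-\rho}}\|x^K(0)\|_{s,K}.$$
   Context: $d\geq1$ is a fixed integer, $\mathbb{N}=\{0,1,\dots\}$, $|k|=|k_1|+\cdots+|k_d|$ for $k\in\mathbb{Z}^d$, $\langle t\rangle=(1+|t|^2)^{1/2}$ and similarly $\langle x\rangle=(1+|x|^2)^{1/2}$. $\|x\|_s=\big(\sum_{k\in\mathbb{Z}^d}(1+|k|)^{2s}|x_k|^2\big)^{1/2}$ and $h^s$ is the space of complex sequences on $\mathbb{Z}^d$ with finite norm. Infinite matrices $A:\mathbb{Z}^d\times\mathbb{Z}^d\to\mathbb{C}$ act by $(Ax)_m=\sum_nA(m,n)x_n$, and $A^*(m,n)=\overline{A(n,m)}$; Hermitian means $A=A^*$. With $e_j$ the $j$-th basis vector, $(\Delta_j^\pm A)(m,n)=A(m\pm e_j,n\pm e_j)-A(m,n)$; for $a\in\mathbb{Z}$, $\Delta_j^a=(\Delta_j^+)^a$ if $a\geq0$, $(\Delta_j^-)^{|a|}$ if $a\leq0$; $\Delta^\alpha=\Delta_1^{\alpha_1}\cdots\Delta_d^{\alpha_d}$ for $\alpha\in\mathbb{Z}^d$. Set $\|A\|_{\alpha,N,r}=\sup_{m,n\in\mathbb{Z}^d}|(\Delta^\alpha A)(m,n)|(1+|m-n|)^N(1+|m|+|n|)^{|\alpha|-r}$; $\mathcal{A}_r$ is the Fréchet space of infinite matrices for which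 all these semi-norms ($\alpha\in\mathbb{Z}^d$, $N\in\mathbb{N}$) are finite. $A_\Phi$ is the diagonal matrix $A_\Phi(m,n)=\Phi(m)\delta_{mn}$. For $K\in2\mathbb{N}^*$ (positive even integers), $\mathbb{Z}_K^d=(\mathbb{Z}/K\mathbb{Z})^d$; for $a\in\mathbb{Z}_K^d$, $\hat a$ is its representative in $\{-K/2,\dots,K/2-1\}^d$ and $[a]=|\hat a_1|+\cdots+|\hat a_d|$. $\ell^2(\mathbb{Z}_K^d)=\mathbb{C}^{\mathbb{Z}_K^d}$ and $\|y\|_{s,K}^2=\sum_{k\in\mathbb{Z}_K^d}(1+[k])^{2s}|y_k|^2$. For families $B^\bullet=\{B^K\}_{K\in2\mathbb{N}^*}$ of matrices $B^K:\mathbb{Z}_K^d\times\mathbb{Z}_K^d\to\mathbb{C}$, set $(\Delta_j^\pm B^K)(m,n)=B^K(m\pm e_j,n\pm e_j)-B^K(m,n)$ for $m,n\in\mathbb{Z}_K^d$, where the indices $m\pm e_j$ and $n\pm e_j$ are taken modulo $K$ in each coordinate; for $a\in\mathbb{Z}$, $\Delta_j^aB^K=(\Delta_j^+)^aB^K$ if $a\geq0$ and $\Delta_j^aB^K=(\Delta_j^-)^{|a|}B^K$ if $a\leq0$; and $\Delta^\alpha B^K=\Delta_1^{\alpha_1}\cdots\Delta_d^{\alpha_d}B^K$ for $\alpha\in\mathbb{Z}^d$. Set $\llbracket B^\bullet\rrbracket_{\alpha,N,r}=\sup_{K\in2\mathbb{N}^*}\sup_{m,n\in\mathbb{Z}_K^d}|(\Delta^\alpha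 B^K)(m,n)|(1+[m-n])^N(1+[m]+[n])^{|\alpha|-r}$, and $\mathcal{A}^{\rm per}_r$ is the space of families with all these semi-norms finite, with the corresponding topology. $A_{\Phi,K}$ is the diagonal matrix on $\mathbb{Z}_K^d$ with entries $\Phi(\hat a)$, $a\in\mathbb{Z}_K^d$. *)

(* Defs.v *)
From HB Require Import structures.
From mathcomp Require Import all_boot all_order all_algebra.
From mathcomp Require Import all_classical all_reals all_analysis.
From mathcomp.real_closed Require Import complex.

Set Implicit Arguments.
Unset Strict Implicit.
Unset Printing Implicit Defensive.

Import Order.TTheory GRing.Theory Num.Theory.
Import numFieldNormedType.Exports.

Local Open Scope classical_set_scope.
Local Open Scope ring_scope.
Local Open Scope complex_scope.

Notation cabs := ComplexField.Normc.normc.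

(* Both Z^d and (Z/K)^d are of the form {ffun 'I_d -> T}; the group structure
   used in m + e_j, m - e_j and m - n is the pointwise one, so that for
   T := 'Z_K all shifts are automatically taken modulo K. *)
Notation latt d := {ffun 'I_d -> int}.
Notation torus d K := {ffun 'I_d -> 'Z_K}.
Notation multidx d := {ffun 'I_d -> nat}.

Definition cmat (R : realType) (I : Type) := I -> I -> R[i].

(* K ranges over the positive even integers; 'Z_K is Z/K since then K >= 2. *)
Definition evenpos (K : nat) : bool := (0 < K)%N && ~~ odd K.

Definition l1 (d : nat) (k : latt d) : nat := (\sum_(j < d) `|k j|)%N.

(* representative in [-K/2, K/2 - 1] *)
Definition zrep (K : nat) (a : 'Z_K) : int :=
  if (a < K./2)%N then (a : nat)%:Z else (a : nat)%:Z - K%:Z.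

Definition hat (d K : nat) (a : torus d K) : latt d := [ffun j => zrep (a j)].

Definition tl1 (d K : nat) (a : torus d K) : nat := l1 (hat a).

Definition unitvec (d : nat) (T : pzRingType) (j : 'I_d) : {ffun 'I_d -> T} :=
  [ffun i => (i == j)%:R].

Section Differences.
Variables (R : realType) (d : nat) (T : pzRingType).
Implicit Types A : cmat R {ffun 'I_d -> T}.

Definition shiftdiff (u : {ffun 'I_d -> T}) A : cmat R {ffun 'I_d -> T} :=
  fun m n => A (m + u) (n + u) - A m n.

Definition Delta1 (j : 'I_d) (a : int) A : cmat R {ffun 'I_d -> T} :=
  iter `|a|%N
    (shiftdiff (if 0 <= a then unitvec T j else - unitvec T j)) A.

Definition Delta (alpha : latt d) A : cmat R {ffun 'I_d -> T} :=
  foldr (fun j A' => Delta1 j (alpha j) A') A (enum 'I_d).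

(* the quantity whose supremum is a semi-norm; len is |.| or [.] *)
Definition weighted (len : {ffun 'I_d -> T} -> nat) (alpha : latt d) (N : nat)
    (r : R) A (m n : {ffun 'I_d -> T}) : R :=
  cabs (Delta alpha A m n) * (1 + len (m - n))%:R ^+ N
    * (1 + len m + len n)%:R `^ ((l1 alpha)%:R - r).

End Differences.

Definition seminorm (R : realType) (d : nat) (alpha : latt d) (N : nat) (r : R)
    (A : cmat R (latt d)) : \bar R :=
  ereal_sup [set v | exists m n : latt d,
    v = (weighted (@l1 d) alpha N r A m n)%:E].

(* Families are total in K : nat, but only even positive K are ever looked at. *)
Definition matfamily (R : realType) (d : nat) :=
  forall K : nat, cmat R (torus d K).

Definition seminorm_per (R : realType) (d : nat) (alpha : latt d) (N : nat)
    (r : R) (B : matfamily R d) : \bar R :=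
  ereal_sup [set v | exists (K : nat) (m n : torus d K),
    evenpos K /\ v = (weighted (@tl1 d K) alpha N r (B K) m n)%:E].

Definition in_A (R : realType) (d : nat) (r : R) (A : cmat R (latt d)) : Prop :=
  forall (alpha : latt d) (N : nat), (seminorm alpha N r A < +oo)%E.

Definition in_Aper (R : realType) (d : nat) (r : R) (B : matfamily R d) : Prop :=
  forall (alpha : latt d) (N : nat), (seminorm_per alpha N r B < +oo)%E.

(* Continuity for the topologies generated by the semi-norms. *)
Definition continuous_A (R : realType) (d : nat) (r : R)
    (B : R -> cmat R (latt d)) : Prop :=
  (forall t, in_A r (B t)) /\
  forall (alpha : latt d) (N : nat) (t0 : R),
    (fun t => seminorm alpha N r (fun m n => B t m n - B t0 m n)) @ t0 --> 0%E.

Definition continuous_Aper (R : realType) (d : nat) (r : R)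
    (B : R -> matfamily R d) : Prop :=
  (forall t, in_Aper r (B t)) /\
  forall (alpha : latt d) (N : nat) (t0 : R),
    (fun t => seminorm_per alpha N r (fun K m n => B t K m n - B t0 K m n))
      @ t0 --> 0%E.

Definition adjoint (R : realType) (I : Type) (A : cmat R I) : cmat R I :=
  fun m n => (A n m)^*.

Definition japanese (R : realType) (t : R) : R := Num.sqrt (1 + t ^+ 2).

(* Euclidean norm; the library norm on row vectors is the sup norm. *)
Definition japanese_vec (R : realType) (d : nat) (x : 'rV[R]_d) : R :=
  Num.sqrt (1 + \sum_(j < d) x 0 j ^+ 2).

Section Smooth.
Variables (R : realType) (d : nat).
Implicit Types Phi : 'rV[R]_d -> R.

Definition pderiv (j : 'I_d) Phi : 'rV[R]_d -> R :=
  fun x => 'D_(delta_mx 0 j) Phi x.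

(* C^infinity: all iterated pderiv derivatives, in any order, exist
   and are continuous. *)
Definition smooth Phi : Prop :=
  forall js : seq 'I_d,
    let D := foldr pderiv Phi js in
    (forall x, continuous_at x D) /\
    (forall x j, derivable D x (delta_mx 0 j)).

Definition mpderiv (alpha : multidx d) Phi : 'rV[R]_d -> R :=
  foldr (fun j f => iter (alpha j) (pderiv j) f) Phi (enum 'I_d).

Definition symbol_class (r : R) Phi : Prop :=
  smooth Phi /\
  forall alpha : multidx d, exists c : R, forall x : 'rV[R]_d,
    `|mpderiv alpha Phi x|
      <= c * japanese_vec x `^ (r - (\sum_(j < d) alpha j)%:R).

Definition at_latt Phi (k : latt d) : R := Phi (\row_j (k j)%:~R).

Definition diagA Phi : cmat R (latt d) :=
  fun m n => if m == n then (at_latt Phi m)%:C else 0.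

Definition diagAK Phi : matfamily R d :=
  fun K m n => if m == n then (at_latt Phi (hat m))%:C else 0.

End Smooth.

Section Sums.
Variables (R : realType) (I : choiceType).

(* Sum of an absolutely summable family, as the difference of the sums of its
   positive and negative parts. When summability fails the value is junk, but
   the rows of a matrix in A_r are summable against any sequence in h^s. *)
Definition rsum (f : I -> R) : R :=
  fine (\esum_(k in [set: I]) (Num.max (f k) 0)%:E)
  - fine (\esum_(k in [set: I]) (Num.max (- f k) 0)%:E).

Definition csum (f : I -> R[i]) : R[i] :=
  rsum (fun k => complex.Re (f k)) +i* rsum (fun k => complex.Im (f k)).

Definition mxact (A : cmat R I) (x : I -> R[i]) : I -> R[i] :=
  fun m => csum (fun n => A m n * x n).

End Sums.

Definition mxactK (R : realType) (I : finType) (A : cmat R I) (x : I -> R[i]) :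
    I -> R[i] :=
  fun m => \sum_n A m n * x n.

Definition hs_norm (R : realType) (d : nat) (s : R) (x : latt d -> R[i]) :
    \bar R :=
  poweR (\esum_(k in [set: latt d])
    ((1 + l1 k)%:R `^ (2 * s) * cabs (x k) ^+ 2)%:E) 2^-1.

Definition hs_normK (R : realType) (d K : nat) (s : R)
    (y : torus d K -> R[i]) : R :=
  Num.sqrt (\sum_k (1 + tl1 k)%:R `^ (2 * s) * cabs (y k) ^+ 2).

Definition is_cderive (R : realType) (f : R -> R[i]) (t : R) (z : R[i]) : Prop :=
  is_derive t 1 (fun u => complex.Re (f u)) (complex.Re z) /\
  is_derive t 1 (fun u => complex.Im (f u)) (complex.Im z).

(* x is a continuous curve in h^s solving the system coordinatewise; no
   differentiability in a norm is assumed. *)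
Definition solution (R : realType) (d : nat) (s : R) (A : cmat R (latt d))
    (B : R -> cmat R (latt d)) (x : R -> latt d -> R[i]) : Prop :=
  [/\ forall t, (hs_norm s (x t) < +oo)%E,
      forall t0, (fun t => hs_norm s (fun k => x t k - x t0 k)) @ t0 --> 0%E
    & forall t m, is_cderive (fun u => x u m) t
        ((0 +i* 1) * mxact A (x t) m + (0 +i* 1) * mxact (B t) (x t) m)].

Definition solutionK (R : realType) (d K : nat) (A : cmat R (torus d K))
    (B : R -> cmat R (torus d K)) (y : R -> torus d K -> R[i]) : Prop :=
  forall t m, is_cderive (fun u => y u m) t
    ((0 +i* 1) * mxactK A (y t) m + (0 +i* 1) * mxactK (B t) (y t) m).

(* Main.v *)
Require Import Defs.
From mathcomp Require Import all_boot all_order all_algebra.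
From mathcomp Require Import all_classical all_reals all_analysis.
From mathcomp Require Import finmap.
From mathcomp Require Import zify ring lra.
From mathcomp.real_closed Require Import complex.

Set Implicit Arguments.
Unset Strict Implicit.
Unset Printing Implicit Defensive.

Import Order.TTheory GRing.Theory Num.Theory.
Import numFieldNormedType.Exports.

Local Open Scope classical_set_scope.
Local Open Scope ring_scope.

(** The matrices enter through the semi-norm with alpha = 0 and one large N, that
    is, |B(m,n)| <= C (1+|m-n|)^-N (1+|m|+|n|)^rho, and the proof is an energy
    estimate with a weight adapted to the time at which the bound is wanted. Put
    a = 1 - rho and, for tau >= 1, let

      g(k) = tau + (1+|k|)^a,     f(k) = g(k)^p,     p = 2s/a.

    Then (1+|k|)^(2s) <= f(k) <= (2 tau)^p (1+|k|)^(2s). The diagonal part of the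
    equation is real, hence does not contribute to the derivative of
    F = sum_k f(k) |x_k|^2, and as B is Hermitian that derivative only sees the
    commutator entries (f(m) - f(n)) B(m,n). Differentiating f costs
    p g^(p-1) |k|^(a-1) = p f |k|^(-rho) / g, the loss |k|^rho of B is exactly
    compensated, and 1/g <= 1/tau remains:

      |f(m) - f(n)| |B(m,n)| <= (c/tau) (1+|m-n|)^(-2d) min(f(m), f(n)).

    Schur's test gives |F'| <= (D/tau) F with D independent of tau. Choosing
    tau = <t>, the energy grows at most by a fixed factor between 0 and t, and
    comparing f with (1+|k|)^(2s) at both ends costs (2 <t>)^p. The square root
    of this is the claim, with the exponent p/2 = s/(1-rho).

    On the infinite lattice F cannot be differentiated termwise, since the
    solution is only known to be continuous in h^s while B may lose rho
    derivatives. The weight f is therefore replaced by f max(0, 1 - e g), which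
    is finitely supported and satisfies the commutator estimate uniformly in e
    (cut_gauge_commutator_le). The resulting finite energy obeys
    |F_e'| <= (D/tau) sup F (commutator_flux_le), and e tends to 0
    (energy_growth). The passage from this integrated inequality to a growth
    bound is a Gronwall argument by successive doublings (iterated_doubling).

    All this is done in evolution_growth for an abstract index set with a length
    and a distance, with constants depending only on the sums of
    (1 + dist)^(-2d). It applies to Z^d and, uniformly in K, to (Z/K)^d. *)

(** * Weights and their commutator estimate *)

Section Weights.
Context {R : realType}.
Implicit Types a b c e p q rho s tau u v x y : R.

(** Mean value inequality for the power p, with the constant p u^p / v in place
    of the supremum of the derivative. It follows from convexity of the
    exponential, (v/u)^p >= 1 - p ln (u/v), which treats p < 1 and p >= 1 alike;
    the ratio u/v that it loses is later paid for by the off-diagonal decay. *)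
Lemma powR_sub_le p u v : 0 <= p -> 0 < v -> v <= u ->
  u `^ p - v `^ p <= p * u `^ p * ((u - v) / v).
Proof.
move=> p0 v0 vu; have u0 : 0 < u := lt_le_trans v0 vu.
have vN0 : v != 0 by rewrite gt_eqF.
have d0 : 0 <= (u - v) / v by rewrite divr_ge0 ?(ltW v0)// subr_ge0.
(* Factoring out u^p reduces the claim to the ratio v/u <= 1. *)
have -> : v `^ p = u `^ p * (v / u) `^ p.
  by rewrite -powRM ?ltW ?divr_gt0// mulrCA divff ?mulr1// gt_eqF.
have ln_ratio : ln (v / u) = - ln (1 + (u - v) / v).
  rewrite -lnV ?posrE; last lra.
  by rewrite -{1}(divff vN0) -mulrDl subrKC invf_div.
have ratio_ge : 1 - p * ((u - v) / v) <= (v / u) `^ p.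
  rewrite /powR mulf_eq0 invr_eq0 (negPf vN0) (gt_eqF u0) /=.
  apply: le_trans (expR_ge1Dx _); rewrite lerD2l ln_ratio mulrN lerN2.
  rewrite ler_wpM2l// le_ln1Dx//; lra.
have := ler_wpM2l (powR_ge0 u p) ratio_ge; nra.
Qed.

Definition cutoff e u : R := Num.max 0 (1 - e * u).

Lemma cutoff_ge0 e u : 0 <= cutoff e u.
Proof. by rewrite le_max lexx. Qed.

Lemma cutoff_le1 e u : 0 <= e -> 0 <= u -> cutoff e u <= 1.
Proof. by move=> e0 u0; rewrite ge_max ler01 lerBlDr lerDl mulr_ge0. Qed.

(** The bound does not depend on e: where the cut-off is not constant one has
    e v <= 1, hence the slope e is at most 1/v. *)
Lemma cutoff_sub_le e u v : 0 <= e -> 0 < v -> v <= u ->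
  `|cutoff e u - cutoff e v| <= (u - v) / v.
Proof.
move=> e0 v0 vu; have euv : 0 <= e * (u - v) by rewrite mulr_ge0 ?subr_ge0.
have [ev|ev] := leP (e * v) 1; last first.
  have [eu ev'] : 1 - e * u <= 0 /\ 1 - e * v <= 0 by split; nra.
  by rewrite /cutoff !max_l// subrr normr0 divr_ge0 ?(ltW v0) ?subr_ge0.
have le_e : e * (u - v) <= (u - v) / v.
  by rewrite mulrC ler_wpM2l ?subr_ge0// -(ler_pM2r v0) mulVf ?gt_eqF.
apply: le_trans le_e; rewrite /cutoff (max_r (x := 0) (y := 1 - e * v)); last nra.
have [eu|eu] := leP (1 - e * u) 0;
  by rewrite ler_norml; apply/andP; split; nra.
Qed.

Definition cut_powR e p u : R := u `^ p * cutoff e u.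

(** Truncation only turns the constant p of powR_sub_le into p + 1, uniformly
    in e. This is what makes the truncated weights usable in the limit. *)
Lemma cut_powR_sub_le e p u v : 0 <= e -> 0 <= p -> 0 < v -> v <= u ->
  `|cut_powR e p u - cut_powR e p v| <= (p + 1) * u `^ p * ((u - v) / v).
Proof.
move=> e0 p0 v0 vu; have u0 : 0 < u := lt_le_trans v0 vu.
have vpup : v `^ p <= u `^ p by rewrite ge0_ler_powR// nnegrE ltW.
have -> : cut_powR e p u - cut_powR e p v =
  (u `^ p - v `^ p) * cutoff e u + v `^ p * (cutoff e u - cutoff e v).
  by rewrite /cut_powR; ring.
rewrite (le_trans (ler_normD _ _))// !normrM mulrDl mulrDl mul1r lerD//.
  rewrite ger0_norm ?subr_ge0// ger0_norm ?cutoff_ge0//.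
  rewrite -[leRHS]mulr1 ler_pM ?cutoff_ge0 ?subr_ge0 ?cutoff_le1 ?powR_sub_le//.
  exact: ltW.
by rewrite ler_pM ?cutoff_sub_le// ger0_norm ?powR_ge0.
Qed.

Definition gauge tau a x : R := tau + x `^ a.

Lemma gauge_gt0 tau a x : 0 < tau -> 0 < gauge tau a x.
Proof. by move=> t0; rewrite ltr_wpDr ?powR_ge0. Qed.

(** Peetre-type inequality: weights at two points are comparable up to a power
    of their distance q. *)
Lemma gauge_le_mul tau a x y q : 0 <= tau -> 0 <= a -> 0 <= x -> 0 <= y ->
  1 <= q -> x <= y * q -> gauge tau a x <= q `^ a * gauge tau a y.
Proof.
move=> t0 a0 x0 y0 q1 xyq; have q0 : 0 <= q by rewrite (le_trans ler01).
rewrite /gauge mulrDr lerD//.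
  by rewrite ler_peMl// -(powRr0 q) ler_powR.
by rewrite -powRM// mulrC ge0_ler_powR ?nnegrE ?mulr_ge0.
Qed.

Lemma gauge_powR_le_mul tau a p x y q : 0 <= tau -> 0 <= a -> 0 <= p ->
  0 <= x -> 0 <= y -> 1 <= q -> x <= y * q ->
  gauge tau a x `^ p <= q `^ (a * p) * gauge tau a y `^ p.
Proof.
move=> t0 a0 p0 x0 y0 q1 xyq; have q0 : 0 <= q by rewrite (le_trans ler01).
have gge0 z : 0 <= gauge tau a z by rewrite addr_ge0 ?powR_ge0.
rewrite powRrM -powRM ?powR_ge0//.
by rewrite ge0_ler_powR ?nnegrE ?mulr_ge0 ?powR_ge0 ?gauge_le_mul.
Qed.

(** For rho > 0 this uses x + y - 1 <= 2 x, and for rho <= 0 monotonicity; the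
    constant 2 serves both cases because rho < 1. *)
Lemma powR_opp_le rho x y : rho < 1 -> 1 <= y -> y <= x ->
  x `^ (- rho) <= 2 * (x + y - 1) `^ (- rho).
Proof.
move=> rho1 y1 yx; have x0 : 0 < x by lra.
have z0 : 0 < x + y - 1 by lra.
have [rho0|rho0] := leP rho 0.
  have : x `^ (- rho) <= (x + y - 1) `^ (- rho).
    by rewrite ge0_ler_powR ?nnegrE ?oppr_ge0//; lra.
  have := powR_ge0 (x + y - 1) (- rho); lra.
rewrite !powRN -lef_pV2 ?posrE ?mulr_gt0 ?invr_gt0 ?powR_gt0//.
rewrite invfM !invrK mulrC ler_pdivrMr//.
have : (x + y - 1) `^ rho <= (2 * x) `^ rho.
  by rewrite ge0_ler_powR ?nnegrE//; lra.
rewrite powRM//; last lra.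
have : 2 `^ rho <= 2 :> R by rewrite ler1_powR//; lra.
have := powR_ge0 x rho; nra.
Qed.

(** The derivative of z^(1-rho) is of order z^(-rho), which is the inverse of
    the growth rate of the matrix entries near z. *)
Lemma gauge_sub_le rho tau x y q : 0 < tau -> rho < 1 -> 1 <= y -> y <= x ->
  1 <= q -> x <= y * q -> x - y <= q ->
  gauge tau (1 - rho) x - gauge tau (1 - rho) y <=
  2 * (1 - rho) * q ^+ 2 * (x + y - 1) `^ (- rho).
Proof.
move=> t0 rho1 y1 yx q1 xyq xy_q.
have y0 : 0 < y by lra.
have x0 : 0 < x by lra.
have a0 : 0 < 1 - rho by lra.
rewrite /gauge opprD addrACA subrr add0r.
apply: le_trans (powR_sub_le (ltW a0) y0 yx) _.
rewrite powRD; last by rewrite (gt_eqF x0) implybT.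
rewrite powRr1 ?(ltW x0)//.
have : x * ((x - y) / y) <= q ^+ 2.
  rewrite mulrA ler_pdivrMr//; have : 0 <= x - y by lra.
  nra.
move=> h.
rewrite [leLHS](_ : _ = (1 - rho) * (x `^ (- rho) * (x * ((x - y) / y)))); last by ring.
rewrite [leRHS](_ : _ = (1 - rho) * ((2 * (x + y - 1) `^ (- rho)) * q ^+ 2)); last by ring.
rewrite ler_pM2l// ler_pM ?powR_ge0 ?powR_opp_le//.
by rewrite mulr_ge0 ?(ltW x0)// divr_ge0 ?(ltW y0)// subr_ge0.
Qed.

(** The heart of the estimate: the gain -rho of gauge_sub_le cancels the growth
    rho of the entry b, dividing by the gauge gives 1/tau, and M + 2 of the
    M + D + 2 powers of off-diagonal decay are spent on the comparison of
    weights (2s <= M) and on q^2. The variables x, y, q stand for 1+|m|, 1+|n|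
    and 1+|m-n|. *)
Lemma cut_gauge_commutator_le rho s tau e x y q b C (D M : nat) :
  let a := 1 - rho in let p := 2 * s / a in
  let h z := cut_powR e p (gauge tau a z) in
  0 < tau -> rho < 1 -> 0 <= s -> 0 <= e -> 1 <= x -> 1 <= y ->
  1 <= q -> x <= y * q -> y <= x * q -> `|x - y| <= q -> 0 <= b ->
  2 * s <= M%:R ->
  b * q ^+ (M + D).+2 * (x + y - 1) `^ (- rho) <= C ->
  `|h x - h y| * b <= 2 * (a + 2 * s) * C / tau * q ^- D
    * Num.min (gauge tau a x `^ p) (gauge tau a y `^ p).
Proof.
move=> a p h t0 rho1 s0 e0 + + q1 + + + b0 sM.
wlog yx : x y / y <= x.
  move=> H x1 y1 xyq yxq xy bC; have [yx|xy'] := leP y x; first exact: H.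
  rewrite distrC minC; apply: H => //; rewrite ?(ltW xy')// 1?distrC//.
  by rewrite (addrC y).
move=> x1 y1 xyq yxq; rewrite ger0_norm ?subr_ge0// => xy_q bC.
have a0 : 0 < a by rewrite subr_gt0.
have p0 : 0 <= p by rewrite /p divr_ge0 ?mulr_ge0 ?(ltW a0).
have x0 : 0 < x by lra.
have y0 : 0 < y by lra.
have q0 : 0 < q by lra.
set gx := gauge tau a x; set gy := gauge tau a y.
have gy0 : 0 < gy by exact: gauge_gt0.
have gyx : gy <= gx by rewrite lerD2l ge0_ler_powR ?nnegrE ?(ltW a0) ?(ltW x0) ?(ltW y0).
rewrite min_r; last by rewrite ge0_ler_powR ?nnegrE ?(ltW gy0)// (le_trans (ltW gy0)).
have S1 : `|h x - h y| * b <=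
    (p + 1) * gx `^ p * (2 * a * q ^+ 2 * (x + y - 1) `^ (- rho) / tau) * b.
  rewrite ler_wpM2r//; apply: le_trans (cut_powR_sub_le _ _ _ _) _ => //.
  rewrite ler_wpM2l ?mulr_ge0 ?powR_ge0 ?addr_ge0//.
  rewrite ler_pM ?subr_ge0 ?invr_ge0 ?(ltW gy0) ?gauge_sub_le//.
  by rewrite lef_pV2 ?posrE// lerDl powR_ge0.
have S2 : gx `^ p <= q ^+ M * gy `^ p.
  apply: le_trans (gauge_powR_le_mul (q := q) (y := y) _ _ _ _ _ _ _) _;
    rewrite ?(ltW t0) ?(ltW a0) ?(ltW x0) ?(ltW y0)//.
  rewrite ler_wpM2r ?powR_ge0// -powR_mulrn ?(ltW q0)// ler_powR//.
  by rewrite /p mulrC divfK// gt_eqF.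
have S3 : q ^+ M * q ^+ 2 * (x + y - 1) `^ (- rho) * b <= C * q ^- D.
  rewrite ler_pdivlMr ?exprn_gt0//; apply: le_trans bC; rewrite le_eqVlt.
  by apply/orP; left; apply/eqP; rewrite -[(M + D).+2]addn2 !exprD; ring.
have c0 : 0 <= (p + 1) * (2 * a) / tau.
  apply: divr_ge0 (ltW t0).
  exact: mulr_ge0 (addr_ge0 p0 ler01) (mulr_ge0 (ler0n _ _) (ltW a0)).
apply: (le_trans S1).
have -> : 2 * (a + 2 * s) = (p + 1) * (2 * a).
  by rewrite /p; field; rewrite gt_eqF.
rewrite [leRHS](_ : _ = ((p + 1) * (2 * a) / tau * gy `^ p) * (C * q ^- D)); last by ring.
apply: (@le_trans _ _ (((p + 1) * (2 * a) / tau) * (q ^+ M * gy `^ p)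
   * (q ^+ 2 * (x + y - 1) `^ (- rho) * b))).
  rewrite [leLHS](_ : _ = (p + 1) * (2 * a) / tau * gx `^ p
    * (q ^+ 2 * (x + y - 1) `^ (- rho) * b)); last by ring.
  rewrite ler_wpM2r ?mulr_ge0 ?powR_ge0 ?exprn_ge0// ?(ltW q0)//.
  by rewrite ler_wpM2l.
rewrite [leLHS](_ : _ = ((p + 1) * (2 * a) / tau * gy `^ p) *
  (q ^+ M * q ^+ 2 * (x + y - 1) `^ (- rho) * b)); last by ring.
by rewrite ler_wpM2l// mulr_ge0 ?powR_ge0.
Qed.

End Weights.
(** * Unordered sums *)

Section Sums.
Context {R : realType} {I : choiceType}.
Implicit Types (f g : I -> R) (J : {fset I}) (z e M : R).

Lemma ler_sum_subfset J J' f : (forall k, 0 <= f k) -> (J `<=` J')%fset ->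
  \sum_(k <- J) f k <= \sum_(k <- J') f k.
Proof.
move=> f0 JJ'; rewrite -lee_fin -!sumEFin; apply: lee_sum_nneg_subfset.
  exact/fsubsetP.
by move=> k _ _; rewrite lee_fin.
Qed.

Lemma le_sum_esum f J : (forall k, 0 <= f k) ->
  ((\sum_(k <- J) f k)%:E <= \esum_(k in [set: I]) (f k)%:E)%E.
Proof.
move=> f0; rewrite -sumEFin; apply: esum_ge; exists [set` J].
  by split; [exact: finite_fset|].
by rewrite fsbig_finite ?set_fsetK//; exact: finite_fset.
Qed.

Lemma esum_le f M : (forall J, \sum_(k <- J) f k <= M) ->
  (\esum_(k in [set: I]) (f k)%:E <= M%:E)%E.
Proof.
move=> fM; apply: ge_ereal_sup => _ [A [finA _] <-].
by rewrite fsbig_finite//= sumEFin lee_fin.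
Qed.

(** Convergence of the net of finite partial sums. Manipulating the rows of the
    matrices through this notion reduces every identity on infinite sums to
    one on a finite index set. *)
Definition sum_to f z := forall e, 0 < e ->
  exists J0, forall J, (J0 `<=` J)%fset -> `|z - \sum_(k <- J) f k| <= e.

Lemma sum_to_esum f M : (forall k, 0 <= f k) ->
  (forall J, \sum_(k <- J) f k <= M) ->
  sum_to f (fine (\esum_(k in [set: I]) (f k)%:E)%E).
Proof.
move=> f0 fM e e0; set S := esum _ _.
have Sfin : S \is a fin_num.
  rewrite ge0_fin_numE ?(le_lt_trans (esum_le fM)) ?ltry//.
  by rewrite esum_ge0// => k _; rewrite lee_fin.
have [_ [A [finA _] <-]] := ub_ereal_sup_adherent e0 Sfin.
rewrite -[X in (X - _)%E]/S fsbig_finite//= sumEFin -(fineK Sfin) -EFinB lte_fin => SA.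
exists (fset_set A) => J AJ.
have sAJ := ler_sum_subfset f0 AJ.
have := le_sum_esum J f0; rewrite -/S -(fineK Sfin) lee_fin => SJ.
by rewrite ger0_norm ?subr_ge0//; lra.
Qed.

Lemma sum_to_linear c f g z z' : sum_to f z -> sum_to g z' ->
  sum_to (fun k => c * f k + g k) (c * z + z').
Proof.
move=> fz gz' e e0; have c1 : 0 < `|c| + 1 by rewrite ltr_wpDl.
have e10 : 0 < e / 2 / (`|c| + 1) by rewrite !divr_gt0.
have e20 : 0 < e / 2 by rewrite divr_gt0.
have [J1 J1P] := fz _ e10; have [J2 J2P] := gz' _ e20.
exists (J1 `|` J2)%fset => J; rewrite fsubUset => /andP[/J1P J1J /J2P J2J].
rewrite big_split/= -mulr_sumr opprD addrACA -mulrBr.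
rewrite (le_trans (ler_normD _ _))// [leRHS](splitr e) lerD// normrM.
move: J1J; rewrite ler_pdivlMr// mulrDr mulr1 mulrC.
have := normr_ge0 (z - \sum_(k <- J) f k); lra.
Qed.

Lemma sum_to_lincomb (M : eqType) (r : seq M) (a b : M -> R)
    (f g : M -> I -> R) (z z' : M -> R) :
  (forall m, sum_to (f m) (z m)) -> (forall m, sum_to (g m) (z' m)) ->
  sum_to (fun k => \sum_(m <- r) (a m * f m k + b m * g m k))
         (\sum_(m <- r) (a m * z m + b m * z' m)).
Proof.
move=> fz gz'; elim: r => [|m r IH].
  move=> e e0; exists fset0 => J _.
  rewrite big_nil (eq_bigr (fun=> 0)) => [|k _]; last by rewrite big_nil.
  by rewrite big1// subrr normr0 ltW.
rewrite big_cons -addrA; under eq_fun do rewrite big_cons -addrA.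
by apply: sum_to_linear => //; apply: sum_to_linear.
Qed.

Lemma sum_to_norm_le f z J0 c : sum_to f z ->
  (forall J, (J0 `<=` J)%fset -> `|\sum_(k <- J) f k| <= c) -> `|z| <= c.
Proof.
move=> fz fc; apply/ler_addgt0Pr => e e0; have [J1 J1P] := fz e e0.
rewrite -(subrK (\sum_(k <- (J0 `|` J1)%fset) f k) z) addrC.
by rewrite (le_trans (ler_normD _ _))// lerD ?fc ?J1P ?fsubsetUl ?fsubsetUr.
Qed.

(** Links the sum defined through positive and negative parts, meaningful only
    for absolutely summable families, to the net of partial sums. *)
Lemma sum_to_rsum f M : (forall J, \sum_(k <- J) `|f k| <= M) ->
  sum_to f (rsum f).
Proof.
move=> fM; have fE : f = (fun k => Num.max (f k) 0 - Num.max (- f k) 0).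
  apply/funext => k; have [fk|fk] := leP (f k) 0.
    by rewrite max_l ?oppr_ge0// sub0r opprK.
  by rewrite max_r ?subr0// oppr_le0 ltW.
have maxN k : Num.max (f k) 0 <= `|f k| /\ Num.max (- f k) 0 <= `|f k|.
  by rewrite !ge_max normr_ge0 !andbT ler_norm -normrN ler_norm.
rewrite [X in sum_to X]fE /rsum -(addrC (- _)) -mulN1r.
under eq_fun do rewrite addrC -mulN1r.
apply: sum_to_linear; apply: (@sum_to_esum _ M) => [k|J];
  rewrite ?le_max ?lexx ?orbT//; apply: le_trans (fM J); apply: ler_sum => k _;
  by have [] := maxN k.
Qed.

Lemma sum_to_finite f z J : sum_to f z -> (forall k, k \notin J -> f k = 0) ->
  z = \sum_(k <- J) f k.
Proof.
move=> fz fJ; apply/eqP; rewrite -subr_eq0 -normr_le0; apply/ler_addgt0Pr => e e0.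
have [J0 J0P] := fz e e0; rewrite add0r.
rewrite (big_fset_incl _ (fsubsetUr J0 J)) => [|k _ /fJ//].
exact/J0P/fsubsetUl.
Qed.

End Sums.

(** * Growth by successive doublings *)

Section Gronwall.
Context {R : realType} {K : Type}.
Variables (S : K -> R -> R) (delta T M : R).
Hypothesis delta_ge0 : 0 <= delta.
Hypothesis S_bounded : forall (t : R) k, 0 <= t <= T -> S k t <= M.
Hypothesis S_growth : forall a b G G0 : R, 0 <= a -> a <= b -> b <= T ->
  (forall (t : R) k, a <= t <= b -> S k t <= G) -> (forall k, S k a <= G0) ->
  forall k, S k b <= G0 + delta * (b - a) * G.

(** Starting from the crude bound M, each use of the growth hypothesis replaces
    the current bound G by G0 + G/2; the iterates converge to the fixed point
    2 G0. *)
Lemma short_time_doubling (a b G0 : R) : 0 <= a -> a <= b -> b <= T -> 0 <= G0 ->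
  delta * (b - a) <= 2^-1 -> (forall k, S k a <= G0) ->
  forall k, S k b <= 2 * G0.
Proof.
move=> a0 ab bT G00 hab Sa k; pose M' := Num.max M 0.
have M'0 : 0 <= M' by rewrite le_max lexx orbT.
have iter j : forall t k, a <= t <= b -> S k t <= 2 * G0 + M' / 2 ^+ j.
  elim: j => [|j IH] t l /andP[at_ tb].
    rewrite expr0 divr1 (le_trans (S_bounded l (t := t) _))//.
      by rewrite (le_trans a0 at_) (le_trans tb bT).
    by rewrite -[leLHS]add0r lerD ?mulr_ge0// le_max lexx.
  have Mj : 0 <= M' / 2 ^+ j by rewrite divr_ge0 ?exprn_ge0.
  have := S_growth a0 at_ (le_trans tb bT) _ Sa l.
  move=> /(_ (2 * G0 + M' / 2 ^+ j)) h.
  apply: le_trans (h _) _ => [u m /andP[au ut]|].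
    by rewrite IH// au (le_trans ut).
  rewrite exprSr invfM mulrA.
  have : delta * (t - a) <= 2^-1.
    by apply: le_trans hab; rewrite ler_wpM2l// lerD2r.
  nra.
(* The error M' / 2^n left after n iterations is below any e > 0. *)
apply/ler_addgt0Pr => e e0.
pose n := Num.bound (M' / e); apply: le_trans (iter n b k _) _.
  by rewrite ab lexx.
rewrite lerD2l ler_pdivrMr ?exprn_gt0// -ler_pdivrMl// mulrC.
rewrite (le_trans (ltW (archi_boundP _)))//; first by rewrite divr_ge0// ltW.
by rewrite -/n -natrX ler_nat ltnW// ltn_expl.
Qed.

Lemma iterated_doubling (n : nat) (G0 : R) : (0 < n)%N -> 0 <= T -> 0 <= G0 ->
  delta * T <= n%:R / 2 -> (forall k, S k 0 <= G0) ->
  forall k, S k T <= 2 ^+ n * G0.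
Proof.
move=> n0 T0 G00 hT S0; have nR : 0 < n%:R :> R by rewrite ltr0n.
have H j : (j <= n)%N -> forall k, S k (j%:R * (T / n%:R)) <= 2 ^+ j * G0.
  elim: j => [_ k|j IH jn k]; first by rewrite mul0r expr0 mul1r.
  rewrite exprS -mulrA.
  apply: (short_time_doubling _ _ _ _ _ (IH (ltnW jn))).
  - by rewrite mulr_ge0// divr_ge0.
  - by rewrite ler_wpM2r ?divr_ge0// ler_nat.
  - by rewrite mulrA ler_pdivrMr// mulrC ler_wpM2l// ler_nat.
  - by rewrite mulr_ge0// exprn_ge0.
  - by rewrite -mulrBl -natrB// subSnn mul1r mulrA ler_pdivrMr// [leRHS]mulrC.
move=> k; have := H n (leqnn n) k; by rewrite mulrCA divff ?mulr1// gt_eqF.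
Qed.

End Gronwall.

(** * The energy flux of a Hermitian matrix *)

Section Flux.
Context {R : realType} {I : choiceType}.
Implicit Types (x z : I -> R[i]) (B : cmat R I) (w f : I -> R) (J : {fset I}).

Definition sqmod (z : R[i]) : R := complex.Re z ^+ 2 + complex.Im z ^+ 2.

Lemma sqmod_ge0 (z : R[i]) : 0 <= sqmod z.
Proof. by rewrite addr_ge0 ?sqr_ge0. Qed.

Lemma cabs_sqr (z : R[i]) : cabs z ^+ 2 = sqmod z.
Proof. by case: z => a b; rewrite /= sqr_sqrtr ?addr_ge0 ?sqr_ge0. Qed.

Lemma cabs_ge0 (z : R[i]) : 0 <= cabs z.
Proof. by case: z => u v; exact: sqrtr_ge0. Qed.

Lemma sqmodD_le (z1 z2 : R[i]) : sqmod (z1 + z2) <= 2 * sqmod z1 + 2 * sqmod z2.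
Proof.
case: z1 z2 => [a b] [c d]; rewrite /sqmod /=.
have := sqr_ge0 (a - c); have := sqr_ge0 (b - d); nra.
Qed.

(** With z = sum_n b(m,n) x_n, the derivative of |x_m|^2 along x' = i z is
    2 sum_n flux b(m,n) x_m x_n. *)
Definition flux (b xm xn : R[i]) : R :=
  complex.Im xm * complex.Re (b * xn) - complex.Re xm * complex.Im (b * xn).

(** Energy leaving n towards m is energy received by m from n: this is where
    the Hermitian symmetry acts. *)
Lemma fluxC (b xm xn : R[i]) : flux (b^*)%C xn xm = - flux b xm xn.
Proof. by case: b xm xn => [u v] [a b] [c d]; rewrite /flux /=; ring. Qed.

Lemma flux_le (b xm xn : R[i]) : `|flux b xm xn| <= cabs b * ((sqmod xm + sqmod xn) / 2).
Proof.
case: b xm xn => [u v] [a b] [c d]; rewrite /flux /sqmod /=.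
set N := _ / 2.
have N0 : 0 <= N by rewrite divr_ge0// !addr_ge0 ?sqr_ge0.
rewrite -(ger0_norm N0) -(sqrtr_sqr N) -sqrtrM ?addr_ge0 ?sqr_ge0//.
rewrite -sqrtr_sqr ler_wsqrtr//.
have -> : b * (u * c - v * d) - a * (u * d + v * c) =
  u * (b * c - a * d) - v * (b * d + a * c) by ring.
set A := b * c - a * d; set D := b * d + a * c.
have AD : A ^+ 2 + D ^+ 2 <= N ^+ 2.
  have := sqr_ge0 (a ^+ 2 + b ^+ 2 - (c ^+ 2 + d ^+ 2)).
  by rewrite /A /D /N; nra.
apply: le_trans (ler_wpM2l _ AD); last by rewrite addr_ge0 ?sqr_ge0.
have := sqr_ge0 (u * D + v * A); nra.
Qed.

(** Antisymmetry of the flux turns the weight w(m) into the difference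
    (w(m) - w(n))/2, and Schur's test with the symmetric kernel kap concludes.
    The bound is in terms of the larger weight f: the finitely supported w is
    not comparable with its own translates, but f is. Enlarging the support J
    of w to J' on both sides makes the double sum symmetric. *)
Lemma commutator_flux_le B w f (kap : I -> I -> R) x z J S G :
  adjoint B = B ->
  (forall m, sum_to (fun n => complex.Re (B m n * x n)) (complex.Re (z m))) ->
  (forall m, sum_to (fun n => complex.Im (B m n * x n)) (complex.Im (z m))) ->
  (forall m, m \notin J -> w m = 0) -> (forall m, 0 <= f m) ->
  (forall m n, 0 <= kap m n) -> (forall m n, kap m n = kap n m) ->
  (forall m J', \sum_(n <- J') kap m n <= S) ->
  (forall m n, `|w m - w n| * cabs (B m n) <= kap m n * Num.min (f m) (f n)) ->
  (forall J', \sum_(m <- J') f m * sqmod (x m) <= G) -> 0 <= S ->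
  `|\sum_(m <- J) w m * (complex.Im (x m) * complex.Re (z m)
                         - complex.Re (x m) * complex.Im (z m))| <= S * G / 2.
Proof.
move=> Bherm zRe zIm wJ f0 kap0 kapC kapS kapB fG S0.
have fluxA m n : flux (B n m) (x n) (x m) = - flux (B m n) (x m) (x n).
  by rewrite -fluxC -[in LHS]Bherm.
have sums := sum_to_lincomb J (fun m => w m * complex.Im (x m))
  (fun m => - (w m * complex.Re (x m))) zRe zIm.
rewrite (eq_bigr (fun m => w m * complex.Im (x m) * complex.Re (z m)
  + - (w m * complex.Re (x m)) * complex.Im (z m))); last by move=> m _; ring.
apply: (sum_to_norm_le (J0 := J) sums) => J' JJ'.
pose T := \sum_(m <- J') \sum_(n <- J') w m * flux (B m n) (x m) (x n).
have -> : \sum_(k <- J') \sum_(m <- J) (w m * complex.Im (x m)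
    * complex.Re (B m k * x k) + - (w m * complex.Re (x m))
    * complex.Im (B m k * x k)) = T.
  rewrite exchange_big/= (big_fset_incl _ JJ') => [|m _ /wJ wm]; last first.
    by rewrite big1// => n _; rewrite wm; ring.
  by apply: eq_bigr => m _; apply: eq_bigr => n _; rewrite /flux; ring.
(* Exchanging m and n changes the sign of the flux, hence the factor 1/2. *)
have T2 : T = 2^-1 * \sum_(m <- J') \sum_(n <- J')
    (w m - w n) * flux (B m n) (x m) (x n).
  have -> : \sum_(m <- J') \sum_(n <- J') (w m - w n) * flux (B m n) (x m) (x n)
    = T - \sum_(m <- J') \sum_(n <- J') w n * flux (B m n) (x m) (x n).
    rewrite -sumrB; apply: eq_bigr => m _; rewrite -sumrB.
    by apply: eq_bigr => n _; ring.
  have -> : \sum_(m <- J') \sum_(n <- J') w n * flux (B m n) (x m) (x n) = - T.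
    rewrite exchange_big/= -sumrN; apply: eq_bigr => m _; rewrite -sumrN.
    by apply: eq_bigr => n _; rewrite fluxA mulrN.
  by rewrite opprK; field.
have term m n : `|(w m - w n) * flux (B m n) (x m) (x n)| <=
    kap m n * (f m * sqmod (x m)) / 2 + kap n m * (f n * sqmod (x n)) / 2.
  rewrite normrM; apply: le_trans (ler_wpM2l (normr_ge0 _) (flux_le _ _ _)) _.
  have N0 : 0 <= (sqmod (x m) + sqmod (x n)) / 2.
    by rewrite divr_ge0// addr_ge0 ?sqmod_ge0.
  rewrite [leLHS]mulrA (le_trans (ler_wpM2r N0 (kapB m n)))//.
  rewrite (kapC n m) -mulrDl -mulrDr !mulrA ler_wpM2r// -!mulrA ler_wpM2l//.
  by rewrite mulrDr lerD// ler_wpM2r ?sqmod_ge0// ge_min lexx ?orbT.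
rewrite T2 normrM ger0_norm// (le_trans (_ : _ <= 2^-1 * (S * G)))//; last lra.
rewrite ler_wpM2l//.
pose U := \sum_(m <- J') \sum_(n <- J') kap m n * (f m * sqmod (x m)) / 2.
have US : U <= S * G / 2.
  apply: (@le_trans _ _ (\sum_(m <- J') S * (f m * sqmod (x m)) / 2)).
    apply: ler_sum => m _; rewrite -!mulr_suml ler_wpM2r// ler_wpM2r//.
    by rewrite mulr_ge0 ?sqmod_ge0.
  by rewrite -mulr_suml -mulr_sumr ler_wpM2r// ler_wpM2l.
apply: (@le_trans _ _ (U + U)); last lra.
have -> : U + U = \sum_(m <- J') \sum_(n <- J') (kap m n * (f m * sqmod (x m)) / 2
    + kap n m * (f n * sqmod (x n)) / 2).
  rewrite {2}/U exchange_big/= -big_split/=.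
  by apply: eq_bigr => m _; rewrite -big_split.
rewrite (le_trans (ler_norm_sum _ _ _))//; apply: ler_sum => m _.
by rewrite (le_trans (ler_norm_sum _ _ _))//; apply: ler_sum => n _; apply: term.
Qed.

End Flux.

(** * Energy estimate over an abstract index set *)

Section Derivatives.
Context {R : realType}.

(** The real diagonal coefficient phi only rotates the phase, so it drops out. *)
Lemma is_derive_sqmod (phi t : R) (y : R -> R[i]) (z : R[i]) :
  is_cderive y t ((0 +i* 1)%C * (phi%:C%C * y t) + (0 +i* 1)%C * z) ->
  is_derive t 1 (fun u => sqmod (y u))
    (2 * (complex.Im (y t) * complex.Re z - complex.Re (y t) * complex.Im z)).
Proof.
case=> dRe dIm.
have -> : (fun u => sqmod (y u)) =
  (fun u => complex.Re (y u)) ^+ 2 + (fun u => complex.Im (y u)) ^+ 2.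
  by apply/funext => u.
have d := is_deriveD (is_deriveX 2 dRe) (is_deriveX 2 dIm).
apply: (is_derive_eq d).
move: (y t) z {dRe dIm d} => [a b] [c d] /=.
by rewrite -[LHS]/((2 * a ^+ 1) * _ + (2 * b ^+ 1) * _) !expr1; ring.
Qed.

Lemma is_derive_sum_seq (I : Type) (r : seq I) (F : I -> R -> R) (dF : I -> R)
    (w : I -> R) (t : R) :
  (forall m, is_derive t 1 (F m) (dF m)) ->
  is_derive t 1 (fun u => \sum_(m <- r) w m * F m u) (\sum_(m <- r) w m * dF m).
Proof.
move=> dFm; elim: r => [|m r IH].
  rewrite big_nil (_ : (fun _ => _) = cst 0); first exact: is_derive_cst.
  by apply/funext => u; rewrite big_nil.
rewrite big_cons (_ : (fun _ => _) = w m \*: F m + fun u => \sum_(m <- r) w m * F m u).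
  exact: is_deriveD.
by apply/funext => u; rewrite big_cons.
Qed.

Lemma is_derive_MVT_le (f df : R -> R) (a b c : R) : a <= b ->
  (forall t : R, is_derive t 1 f (df t)) ->
  (forall t, a <= t <= b -> `|df t| <= c) -> `|f b - f a| <= c * (b - a).
Proof.
move=> ab fdf dfc.
have cf : {within `[a, b], continuous f}.
  by apply: derivable_within_continuous => t _; have [] := fdf t.
have [t tab ->] := MVT_segment ab (fun t _ => fdf t) cf.
rewrite normrM (ger0_norm (_ : 0 <= b - a)) ?subr_ge0//.
by rewrite ler_wpM2r ?subr_ge0// dfc.
Qed.

End Derivatives.

Section Evolution.
Context {R : realType} {I : choiceType}.
Variables (len : I -> nat) (dist : I -> I -> nat) (D M : nat) (S : R).
Hypothesis distC : forall m n, dist m n = dist n m.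
Hypothesis len_le : forall m n, (len m <= len n + dist m n)%N.
Hypothesis dist_summable : forall m (J : {fset I}),
  \sum_(n <- J) (1 + dist m n)%:R ^- D <= S.
Hypothesis len_ball : forall L, exists J : {fset I}, forall k,
  (len k <= L)%N -> k \in J.

Variables (rho s C : R) (phi : I -> R) (B : R -> cmat R I).
Variables (x z : R -> I -> R[i]).
Hypothesis rho_lt1 : rho < 1.
Hypothesis s_ge0 : 0 <= s.
Hypothesis sM : 2 * s <= M%:R.
Hypothesis B_herm : forall t, adjoint (B t) = B t.
Hypothesis B_le : forall t m n, cabs (B t m n) * (1 + dist m n)%:R ^+ (M + D).+2
  * (1 + len m + len n)%:R `^ (- rho) <= C.
Hypothesis x_deriv : forall t m, is_cderive (fun u => x u m) t
  ((0 +i* 1)%C * ((phi m)%:C%C * x t m) + (0 +i* 1)%C * z t m).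
Hypothesis z_Re : forall t m,
  sum_to (fun n => complex.Re (B t m n * x t n)) (complex.Re (z t m)).
Hypothesis z_Im : forall t m,
  sum_to (fun n => complex.Im (B t m n * x t n)) (complex.Im (z t m)).

Let a := 1 - rho.
Let p := 2 * s / a.
Let W (k : I) : R := (1 + len k)%:R.
Let f tau k := gauge tau a (W k) `^ p.
Let kap tau m n : R := 2 * (a + 2 * s) * C / tau * (1 + dist m n)%:R ^- D.

Let a_gt0 : 0 < a. Proof. by rewrite subr_gt0. Qed.
Let p_ge0 : 0 <= p. Proof. exact: divr_ge0 (mulr_ge0 (ler0n _ _) s_ge0) (ltW a_gt0). Qed.
Let W_ge1 k : 1 <= W k. Proof. by rewrite ler1n. Qed.
Let f_ge0 tau k : 0 <= f tau k. Proof. exact: powR_ge0. Qed.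

Hypothesis S_ge0 : 0 <= S.
Hypothesis C_ge0 : 0 <= C.

Let commutator_le (t e tau : R) m n : 0 <= e -> 0 < tau ->
  `|cut_powR e p (gauge tau a (W m)) - cut_powR e p (gauge tau a (W n))|
    * cabs (B t m n) <= kap tau m n * Num.min (f tau m) (f tau n).
Proof.
move=> e0 t0; have lenle k l : W k <= W l * (1 + dist k l)%:R.
  rewrite -natrM ler_nat; move: (len k) (len l) (dist k l) (len_le k l).
  by move=> u v w h; clear -h; nia.
apply: (cut_gauge_commutator_le (M := M)) => //.
- by rewrite ler1n.
- by rewrite distC.
- rewrite ler_norml lerBrDr lerBlDr addrC -!natrD lerBlDr -natrD !ler_nat.
  move: (len_le m n) (len_le n m); rewrite (distC n m).
  by move: (len m) (len n) (dist m n) => u v w h h'; clear -h h'; lia.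
- exact: cabs_ge0.
- have -> : W m + W n - 1 = (1 + len m + len n)%:R by rewrite /W !natrD; ring.
  exact: B_le.
Qed.

(** The truncated energy is a finite sum, hence differentiable although only
    coordinatewise derivatives of x are known. *)
Let truncated_growth (t0 t1 e tau G : R) (J : {fset I}) : 0 <= e -> 0 < tau -> t0 <= t1 ->
  (forall k, k \notin J -> cut_powR e p (gauge tau a (W k)) = 0) ->
  (forall t (J' : {fset I}), t0 <= t <= t1 -> \sum_(k <- J') f tau k * sqmod (x t k) <= G) ->
  `| \sum_(k <- J) cut_powR e p (gauge tau a (W k)) * sqmod (x t1 k)
   - \sum_(k <- J) cut_powR e p (gauge tau a (W k)) * sqmod (x t0 k) |
    <= 2 * (a + 2 * s) * C / tau * S * G * (t1 - t0).
Proof.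
move=> e0 tau0 t01 wJ fG.
have K0 : 0 <= 2 * (a + 2 * s) * C / tau.
  apply: divr_ge0 (ltW tau0); apply: mulr_ge0 C_ge0.
  exact: mulr_ge0 (ler0n _ _) (addr_ge0 (ltW a_gt0) (mulr_ge0 (ler0n _ _) s_ge0)).
pose w k := cut_powR e p (gauge tau a (W k)).
pose flow t k :=
  complex.Im (x t k) * complex.Re (z t k) - complex.Re (x t k) * complex.Im (z t k).
have dE (t : R) : is_derive t 1 (fun u => \sum_(k <- J) w k * sqmod (x u k))
    (\sum_(k <- J) w k * (2 * flow t k)).
  by apply: is_derive_sum_seq => m; apply: is_derive_sqmod (x_deriv t m).
apply: (is_derive_MVT_le t01 dE) => t tt.
under eq_bigr do rewrite mulrCA.
rewrite -mulr_sumr normrM ger0_norm// mulrC -ler_pdivlMr//.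
apply: (commutator_flux_le (f := f tau) (kap := kap tau)
  (B_herm t) (z_Re t) (z_Im t)) => //.
- by move=> m n; rewrite mulr_ge0// invr_ge0 exprn_ge0.
- by move=> m n; rewrite /kap distC.
- by move=> m J'; rewrite /kap -mulr_sumr ler_wpM2l.
- by move=> m n; apply: commutator_le.
- by move=> J'; apply: fG.
- exact: mulr_ge0.
Qed.

(** The gauge tends to infinity with the length because rho < 1; balls being
    finite, the truncated weight has finite support. *)
Let cut_support (e tau : R) : 0 < e -> 0 < tau -> exists J : {fset I},
  forall k, k \notin J -> cut_powR e p (gauge tau a (W k)) = 0.
Proof.
move=> e0 tau0; have [J JP] := len_ball (Num.bound (e^-1 `^ a^-1)).
exists J => k kJ; rewrite /cut_powR /cutoff max_l ?mulr0// subr_le0.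
have : (Num.bound (e^-1 `^ a^-1) < len k)%N by rewrite ltnNge; apply: contra kJ; exact: JP.
rewrite -(ltr_nat R) => lk.
have W_big : e^-1 `^ a^-1 <= W k.
  apply: (le_trans (ltW (archi_boundP (powR_ge0 _ _)))).
  by rewrite (le_trans (ltW lk))// ler_nat.
rewrite -ler_pdivrMl// mulr1 /gauge ler_wpDl ?(ltW tau0)//.
have -> : e^-1 = (e^-1 `^ a^-1) `^ a.
  by rewrite -powRrM mulVf ?gt_eqF// powRr1// invr_ge0 ltW.
by rewrite ge0_ler_powR ?nnegrE ?powR_ge0 ?(ltW a_gt0)// (le_trans ler01).
Qed.

(** Removing the truncation. The same bound is needed forwards and backwards in
    time, whence the pair (u, v) that is (t0, t1) or (t1, t0). *)
Let energy_growth (t0 t1 tau G G0 : R) : 0 < tau -> t0 <= t1 ->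
  (forall t (J : {fset I}), t0 <= t <= t1 -> \sum_(k <- J) f tau k * sqmod (x t k) <= G) ->
  forall u v, (u = t0 /\ v = t1) \/ (u = t1 /\ v = t0) ->
  (forall J : {fset I}, \sum_(k <- J) f tau k * sqmod (x u k) <= G0) ->
  forall J : {fset I}, \sum_(k <- J) f tau k * sqmod (x v k)
    <= G0 + 2 * (a + 2 * s) * C / tau * S * G * (t1 - t0).
Proof.
move=> tau0 t01 fG u v uv fG0 J; set c := _ * (t1 - t0).
pose g k := gauge tau a (W k).
apply/ler_addgt0Pr => e e0.
pose Q := \sum_(k <- J) f tau k * g k * sqmod (x v k).
have Q0 : 0 <= Q.
  apply: sumr_ge0 => k _; rewrite !mulr_ge0 ?sqmod_ge0 ?f_ge0//.
  by rewrite ltW ?gauge_gt0.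
(* Truncating at scale e' changes the energy over J by at most e' Q <= e. *)
pose e' := e / (Q + 1).
have e'0 : 0 < e' by rewrite divr_gt0// ltr_wpDl.
have e'Q : e' * Q <= e.
  by rewrite /e' mulrAC ler_pdivrMr ?ltr_wpDl// ler_wpM2l ?(ltW e0)// lerDl.
have [J0 J0P] := cut_support e'0 tau0.
pose w k := cut_powR e' p (g k).
pose E t := \sum_(k <- (J0 `|` J)%fset) w k * sqmod (x t k).
(* The index set contains both the support of w and J. *)
have E_diff : E v <= E u + c.
  have := truncated_growth (J := (J0 `|` J)%fset) (ltW e'0) tau0 t01 _ fG.
  have supp k : k \notin (J0 `|` J)%fset -> w k = 0.
    by rewrite inE negb_or => /andP[/J0P].
  move=> /(_ supp); rewrite -/(E t1) -/(E t0) -/c ler_norml => /andP[h1 h2].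
  by case: uv => [] [-> ->]; lra.
have w_le k : w k <= f tau k.
  by rewrite -[leRHS]mulr1 ler_wpM2l ?powR_ge0// cutoff_le1 ?(ltW e'0)// ltW ?gauge_gt0.
have E_u : E u <= G0.
  by apply: le_trans (fG0 (J0 `|` J)%fset); apply: ler_sum => k _; rewrite ler_wpM2r ?sqmod_ge0.
have E_v : \sum_(k <- J) f tau k * sqmod (x v k) <= E v + e' * Q.
  apply: (@le_trans _ _ (\sum_(k <- J) w k * sqmod (x v k) + e' * Q)); last first.
    rewrite lerD2r; apply: ler_sum_subfset; last exact: fsubsetUr.
    by move=> k; rewrite mulr_ge0 ?sqmod_ge0// mulr_ge0 ?powR_ge0 ?cutoff_ge0.
  rewrite /Q mulr_sumr -big_split/=; apply: ler_sum => k _.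
  rewrite -mulrA !mulrA -mulrDl ler_wpM2r ?sqmod_ge0//.
  rewrite /w /cut_powR -/(f tau k) -lerBlDr.
  have : 1 - e' * g k <= cutoff e' (g k) by rewrite le_max lexx orbT.
  move=> /(ler_wpM2l (f_ge0 tau k)); rewrite mulrBr mulr1 mulrCA mulrA.
  by apply: le_trans; rewrite lerB// mulrCA mulrA.
lra.
Qed.

Hypothesis x_bounded : forall T : R, exists M0 : R, forall t (J : {fset I}),
  `|t| <= T -> \sum_(k <- J) W k `^ (2 * s) * sqmod (x t k) <= M0.

Let ap : a * p = 2 * s.
Proof. by rewrite mulrC divfK// gt_eqF. Qed.

Let sobolev_le_f (tau : R) k : 0 <= tau -> W k `^ (2 * s) <= f tau k.
Proof.
move=> tau0; rewrite -ap [W k `^ _]powRrM ge0_ler_powR ?nnegrE ?powR_ge0//.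
  by rewrite addr_ge0 ?powR_ge0.
by rewrite lerDr.
Qed.

Let f_le_sobolev (tau : R) k : 1 <= tau -> f tau k <= (2 * tau) `^ p * W k `^ (2 * s).
Proof.
move=> tau1; have tau0 : 0 <= tau by rewrite (le_trans ler01).
rewrite -ap [W k `^ _]powRrM -powRM ?powR_ge0 ?mulr_ge0//.
have Wa1 : 1 <= W k `^ a by rewrite -(powRr0 (W k)) ler_powR// ltW.
apply: (ge0_ler_powR p_ge0); rewrite ?nnegrE ?mulr_ge0 ?addr_ge0 ?powR_ge0//.
rewrite /gauge.
have := ler_peMl (powR_ge0 (W k) a) tau1; have := ler_peMr tau0 Wa1; lra.
Qed.

(** The constant 2^n depends only on s, rho, C and S, not on the index set nor
    on t: taking tau = <t> makes the growth rate times |t| bounded. *)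
Lemma evolution_growth (n : nat) (t Y0 : R) : (0 < n)%N ->
  4 * (1 - rho + 2 * s) * C * S <= n%:R ->
  (forall J : {fset I},
     \sum_(k <- J) (1 + len k)%:R `^ (2 * s) * sqmod (x 0 k) <= Y0) ->
  forall J : {fset I},
    \sum_(k <- J) (1 + len k)%:R `^ (2 * s) * sqmod (x t k)
      <= 2 ^+ n * ((2 * japanese t) `^ (2 * s / (1 - rho)) * Y0).
Proof.
move=> n0 nC xY0 J; set tau := japanese t.
have tau_ge : `|t| <= tau by rewrite -sqrtr_sqr ler_wsqrtr// lerDr.
have tau1 : 1 <= tau by rewrite -[leLHS]sqrtr1 ler_wsqrtr// lerDl sqr_ge0.
have tau0 : 0 < tau by rewrite (lt_le_trans ltr01).
(* Negative times are treated by running the evolution backwards, x (- u). *)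
have [sg sgE ->] : exists2 sg : R, (sg = 1) \/ (sg = -1) & t = sg * `|t|.
  have [t0|t0] := leP 0 t; first by exists 1; [left|rewrite mul1r ger0_norm].
  by exists (-1); [right|rewrite mulN1r ltr0_norm// opprK].
have nsg u : `|sg * u| = `|u| by case: sgE => ->; rewrite ?mul1r// mulN1r normrN.
have Y00 : 0 <= Y0 by have := xY0 fset0; rewrite big_nil.
pose En (J : {fset I}) u := \sum_(k <- J) f tau k * sqmod (x (sg * u) k).
pose delta := 2 * (a + 2 * s) * C / tau * S.
have as0 : 0 <= a + 2 * s.
  exact: addr_ge0 (ltW a_gt0) (mulr_ge0 (ler0n _ _) s_ge0).
have delta0 : 0 <= delta.
  apply: mulr_ge0 S_ge0; apply: divr_ge0 (ltW tau0); apply: mulr_ge0 C_ge0.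
  exact: mulr_ge0.
have f_sum (J' : {fset I}) u Y :
    \sum_(k <- J') W k `^ (2 * s) * sqmod (x u k) <= Y ->
    \sum_(k <- J') f tau k * sqmod (x u k) <= (2 * tau) `^ p * Y.
  move=> h; apply: le_trans (ler_wpM2l (powR_ge0 _ _) h); rewrite mulr_sumr.
  by apply: ler_sum => k _; rewrite mulrA ler_wpM2r ?sqmod_ge0// f_le_sobolev.
have [M0 M0P] := x_bounded `|t|.
apply: (@le_trans _ _ (En J `|t|)).
  by apply: ler_sum => k _; rewrite ler_wpM2r ?sqmod_ge0// sobolev_le_f// ltW.
apply: (iterated_doubling (delta := delta) (T := `|t|)
  (M := (2 * tau) `^ p * M0) delta0) => //.
- move=> u J' /andP[u0 ut]; apply: f_sum; apply: M0P.
  by rewrite nsg ger0_norm.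
- move=> t0 t1 G G0 _ t01 _ EG EG0 J'; rewrite mulrAC.
  have [sgE1|sgE1] := sgE.
    apply: (@energy_growth t0 t1 tau G G0 tau0 t01 _ (sg * t0) (sg * t1) _ EG0); last by left; rewrite sgE1 !mul1r.
    by move=> u J2 ut; have := EG u J2 ut; rewrite /En sgE1 mul1r.
  have t01' : - t1 <= - t0 by rewrite lerN2.
  rewrite (_ : t1 - t0 = - t0 - - t1); last by rewrite opprK addrC.
  apply: (@energy_growth (- t1) (- t0) tau G G0 tau0 t01' _ (sg * t0) (sg * t1) _ EG0); last by right; rewrite sgE1 !mulN1r.
  move=> u J2 /andP[u1 u2]; have := EG (- u) J2; rewrite /En sgE1 mulN1r opprK.
  by apply; rewrite lerNr u2 lerNl u1.
- by rewrite mulr_ge0 ?powR_ge0.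
- have -> : delta * `|t| = (4 * (a + 2 * s) * C * S) / 2 * (`|t| / tau).
    by rewrite /delta; field; rewrite gt_eqF.
  apply: le_trans (ler_piMr _ _) _.
  + by rewrite divr_ge0// mulr_ge0// mulr_ge0// mulr_ge0.
  + by rewrite ler_pdivrMr// mul1r.
  + by rewrite ler_wpM2r.
- by move=> J'; rewrite /En mulr0; apply: f_sum.
Qed.

End Evolution.

(** * Summability and geometry of the lattice and of the tori *)

Section Lattice.
Context {R : realType}.

Lemma sum_inv_sqr_le n : \sum_(0 <= i < n) (i.+1%:R : R) ^- 2 <= 2.
Proof.
case: n => [|n]; first by rewrite big_nil.
suff : \sum_(0 <= i < n.+1) (i.+1%:R : R) ^- 2 <= 2 - n.+1%:R^-1.
  by move=> /le_trans; apply; rewrite lerBlDr lerDl invr_ge0.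
elim: n => [|n IH]; first by rewrite big_nat1 expr1n; lra.
rewrite big_nat_recr//=; apply: le_trans (lerD IH (lexx _)) _.
set u : R := n.+1%:R; have -> : n.+2%:R = u + 1 by rewrite /u -natr1.
have u0 : 0 < u by rewrite ltr0n.
have -> : 2 - (u + 1)^-1 = (2 - u^-1 + (u + 1) ^- 2) + (u * (u + 1) ^+ 2)^-1.
  by field; rewrite ?gt_eqF// addr_gt0.
by rewrite lerDl invr_ge0 mulr_ge0 ?exprn_ge0 ?addr_ge0 ?ltW.
Qed.

Lemma sum_uniq_inv_sqr_le (r : seq nat) : uniq r ->
  \sum_(i <- r) (i.+1%:R : R) ^- 2 <= 2.
Proof.
move=> ur; pose N := (\max_(i <- r) i).+1.
have rN : perm_eq r [seq i <- iota 0 N | i \in r].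
  apply: uniq_perm => //; first by rewrite filter_uniq// iota_uniq.
  move=> i; rewrite mem_filter mem_iota add0n /=; case: (boolP (i \in r)) => //= ir.
  by rewrite ltnS; apply/esym; exact: leq_bigmax_seq.
rewrite (perm_big _ rN) big_filter; apply: le_trans (sum_inv_sqr_le N).
rewrite /index_iota subn0 big_mkcond/=; apply: ler_sum => i _.
by case: ifP => // _; rewrite invr_ge0 exprn_ge0.
Qed.

(** Stated for an injection into the integers so that it covers the
    representatives of Z/K, uniformly in K, as well as integer intervals: each
    sign contributes at most the sum of 1/i^2, which is at most 2. *)
Lemma sum_int_inv_sqr_le (T : finType) (c : T -> int) : injective c ->
  \sum_a ((1 + `|c a|)%:R : R) ^- 2 <= 4.
Proof.
move=> c_inj; rewrite (bigID (fun a => 0 <= c a))/=.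
have half (P : pred T) : {in P &, injective (fun a => `|c a|%N)} ->
    \sum_(a | P a) ((1 + `|c a|)%:R : R) ^- 2 <= 2.
  move=> Pinj; rewrite -big_filter.
  have := sum_uniq_inv_sqr_le (r := [seq `|c a|%N | a <- index_enum T & P a]).
  rewrite big_map; apply; rewrite map_inj_in_uniq ?filter_uniq ?index_enum_uniq//.
  by move=> a b; rewrite !mem_filter => /andP[Pa _] /andP[Pb _]; exact: Pinj.
rewrite [leRHS](_ : _ = 2 + 2); last by ring.
by apply: lerD; apply: half => a b; rewrite !unfold_in => ha hb h;
  apply: c_inj; move: ha hb h; lia.
Qed.

(** As 1+|k| dominates each 1+|k_j|, the summand is at most the product of the
    (1+|k_j|)^-2, and the sum of the products is the product of the sums. *)
Lemma sum_inv_l1_le (d : nat) (T : finType) (c : T -> int) : injective c ->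
  \sum_(g : {ffun 'I_d -> T})
     ((1 + \sum_(j < d) `|c (g j)|)%:R : R) ^- (2 * d) <= 4 ^+ d.
Proof.
move=> c_inj.
apply: (@le_trans _ _ (\sum_(g : {ffun 'I_d -> T})
    \prod_(j < d) ((1 + `|c (g j)|)%:R : R) ^- 2)).
  apply: ler_sum => g _; rewrite -exprVn exprM -[X in _ ^+ X <= _]card_ord.
  rewrite -prodr_const.
  apply: ler_prod => j _; rewrite exprVn invr_ge0 exprn_ge0//= lef_pV2 ?posrE ?exprn_gt0 ?ltr0n//.
  by rewrite lerXn2r ?nnegrE// ler_nat leq_add2l (bigD1 j)//= leq_addr.
rewrite -(bigA_distr_bigA (fun _ a => ((1 + `|c a|)%:R : R) ^- 2)).
rewrite -[X in _ <= 4 ^+ X]card_ord -prodr_const.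
apply: ler_prod => j _; rewrite sum_int_inv_sqr_le ?andbT//.
by apply: sumr_ge0 => a _; rewrite invr_ge0 exprn_ge0.
Qed.

End Lattice.

Section LatticeGeometry.
Context {R : realType} {d : nat}.
Implicit Types (m n k : latt d) (J : {fset latt d}).

Lemma l1_distC m n : l1 (m - n) = l1 (n - m).
Proof. by apply: eq_bigr => j _; rewrite !ffunE distnC. Qed.

Lemma l1_triangle m n : (l1 m <= l1 n + l1 (m - n)%R)%N.
Proof.
rewrite /l1 -big_split/=; apply: leq_sum => j _; rewrite !ffunE.
by move: (m j) (n j) => u v; lia.
Qed.

Definition box_point L (g : {ffun 'I_d -> 'I_(L.*2.+1)}) : latt d :=
  [ffun j => (g j : nat)%:Z - L%:Z].

(** Finite sets that exhaust the lattice and are products, so that sums of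
    product functions over them factor. *)
Definition box L : {fset latt d} := [fset box_point g | g in [set: {ffun 'I_d -> 'I_(L.*2.+1)}]%SET]%fset.

Lemma mem_box L k : (l1 k <= L)%N -> k \in box L.
Proof.
move=> kL; apply/imfsetP => /=.
exists [ffun j => inord (absz (k j + L%:Z))]; first by rewrite inE.
apply/ffunP => j; rewrite !ffunE inordK.
  have : (`|k j| <= L)%N by apply: leq_trans kL; rewrite /l1 (bigD1 j)//= leq_addr.
  by move: (k j) => u; lia.
have : (`|k j| <= L)%N by apply: leq_trans kL; rewrite /l1 (bigD1 j)//= leq_addr.
by move: (k j) => u; lia.
Qed.

Lemma box_point_inj L : injective (@box_point L).
Proof.
move=> g h gh; apply/ffunP => j; apply: val_inj.
by move/ffunP: gh => /(_ j); rewrite !ffunE => /addIr [].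
Qed.

Lemma l1_summable m J :
  \sum_(n <- J) ((1 + l1 (m - n))%:R : R) ^- (2 * d) <= 4 ^+ d.
Proof.
pose J' := [fset m - n | n in J]%fset; pose L := (\max_(k <- J') l1 k)%N.
have -> : \sum_(n <- J) ((1 + l1 (m - n))%:R : R) ^- (2 * d) =
          \sum_(k <- J') ((1 + l1 k)%:R : R) ^- (2 * d).
  by rewrite big_imfset//= => n n' _ _ /addrI /oppr_inj.
apply: (@le_trans _ _ (\sum_(k <- box L) ((1 + l1 k)%:R : R) ^- (2 * d))).
  apply: ler_sum_subfset => [k|]; first by rewrite invr_ge0 exprn_ge0.
  by apply/fsubsetP => k kJ'; apply: mem_box; exact: leq_bigmax_seq.
rewrite big_imfset/=; last by move=> g h _ _; exact: box_point_inj.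
rewrite big_enum/= big_mkcond/=.
have c_inj : injective (fun i : 'I_(L.*2.+1) => (i : nat)%:Z - L%:Z).
  by move=> i i' /addIr [] /val_inj.
apply: le_trans (sum_inv_l1_le (R := R) d c_inj).
apply: ler_sum => g _; case: ifP => _; last by rewrite invr_ge0 exprn_ge0.
by rewrite /l1; under eq_bigr do rewrite ffunE.
Qed.

End LatticeGeometry.

Section TorusGeometry.
Context {R : realType} {d K : nat}.
Hypothesis K_even : evenpos K.
Implicit Types (a b : 'Z_K) (m n : torus d K).

Let K_gt1 : (1 < K)%N.
Proof. by move: K_even => /andP[]; case: K => [|[|]]. Qed.

Lemma ltn_Zp a : (a < K)%N.
Proof. by have := ltn_ord a; move: (a : nat) => u; rewrite Zp_cast. Qed.

Lemma absz_zrep a : `|zrep a|%N = minn a (K - a).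
Proof.
have aK := ltn_Zp a; rewrite /zrep.
by move: K_even aK => /andP[_]; move: (a : nat) => u; case: ifP; lia.
Qed.

Lemma zrep_inj : injective (@zrep K).
Proof.
move=> a b; have aK := ltn_Zp a; have bK := ltn_Zp b; rewrite /zrep => ab; apply: val_inj => /=.
by move: aK bK ab; move: (a : nat) (b : nat) => u v; case: ifP; case: ifP; lia.
Qed.

(** Explicit residue of a difference, on which the metric properties of the
    torus become linear arithmetic by cases. *)
Lemma val_subZp a b :
  (a - b : 'Z_K) = (if (b <= a)%N then a - b else a + K - b)%N :> nat.
Proof.
have /= := (ltn_Zp a, ltn_Zp b); move: (a : nat) (b : nat) => u v.
rewrite Zp_cast// modnDmr => -[aK bK]; case: ifP => ba.
  rewrite addnBA ?(ltnW bK)// addnC -addnBA// modnDl modn_small//.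
  exact: leq_ltn_trans (leq_subr _ _) aK.
rewrite addnBA ?(ltnW bK)// modn_small//.
by move/negbT: ba; rewrite -ltnNge => ab; lia.
Qed.

Lemma zrep_distC a b : `|zrep (a - b)%R|%N = `|zrep (b - a)%R|%N.
Proof.
have := ltn_Zp a; have := ltn_Zp b; rewrite !absz_zrep !val_subZp.
by case: ifP; case: ifP; lia.
Qed.

Lemma zrep_triangle a b : (`|zrep a| <= `|zrep b| + `|zrep (a - b)%R|)%N.
Proof.
have := ltn_Zp a; have := ltn_Zp b; rewrite !absz_zrep val_subZp.
by case: ifP; lia.
Qed.

Lemma tl1E m : tl1 m = (\sum_(j < d) `|zrep (m j)|)%N.
Proof. by apply: eq_bigr => j _; rewrite ffunE. Qed.

Lemma tl1_distC m n : tl1 (m - n) = tl1 (n - m).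
Proof. by rewrite !tl1E; apply: eq_bigr => j _; rewrite !ffunE zrep_distC. Qed.

Lemma tl1_triangle m n : (tl1 m <= tl1 n + tl1 (m - n)%R)%N.
Proof.
rewrite !tl1E -big_split/=; apply: leq_sum => j _; rewrite !ffunE.
exact: zrep_triangle.
Qed.

Lemma sum_fset_fin (f : torus d K -> R) :
  \sum_(k <- [fset k | k in {: torus d K}]%fset) f k = \sum_k f k.
Proof. by rewrite big_imfset//= big_enum. Qed.

Lemma tl1_summable m (J : {fset torus d K}) :
  \sum_(n <- J) ((1 + tl1 (m - n))%:R : R) ^- (2 * d) <= 4 ^+ d.
Proof.
apply: le_trans (sum_inv_l1_le d zrep_inj).
rewrite (reindex_inj (subrI m))/=; under [leRHS]eq_bigr do rewrite -tl1E.
rewrite -sum_fset_fin; apply: ler_sum_subfset.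
  by move=> k; rewrite invr_ge0 exprn_ge0.
by apply/fsubsetP => k _; apply/imfsetP; exists k.
Qed.

End TorusGeometry.

(** * Semi-norms, matrix action and Sobolev norms *)

Section Seminorms.
Context {R : realType} {d : nat}.

Lemma Delta0 (T : pzRingType) (A : cmat R {ffun 'I_d -> T}) : Delta 0 A = A.
Proof.
by rewrite /Delta; elim: (enum 'I_d) => //= j r ->; rewrite /Delta1 ffunE.
Qed.

Lemma weighted0E (T : pzRingType) (ln : {ffun 'I_d -> T} -> nat) N (rho : R)
    (A : cmat R {ffun 'I_d -> T}) m n :
  weighted ln 0 N rho A m n = cabs (A m n) * (1 + ln (m - n))%:R ^+ N
    * (1 + ln m + ln n)%:R `^ (- rho).
Proof.
by rewrite /weighted Delta0 /l1 big1 ?sub0r// => j _; rewrite ffunE.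
Qed.

Lemma weighted_ge0 (T : pzRingType) (ln : {ffun 'I_d -> T} -> nat) alpha N
    (rho : R) (A : cmat R {ffun 'I_d -> T}) m n :
  0 <= weighted ln alpha N rho A m n.
Proof. by rewrite !mulr_ge0 ?powR_ge0 ?exprn_ge0 ?cabs_ge0. Qed.

Lemma seminorms_le alpha N (rho C : R) (A : cmat R (latt d)) (AK : matfamily R d) :
  (seminorm alpha N rho A + seminorm_per alpha N rho AK <= C%:E)%E ->
  (forall m n, weighted (@l1 d) alpha N rho A m n <= C) /\
  (forall K, evenpos K ->
     forall m n, weighted (@tl1 d K) alpha N rho (AK K) m n <= C).
Proof.
move=> h.
have le1 m n : ((weighted (@l1 d) alpha N rho A m n)%:E <= seminorm alpha N rho A)%E.
  by apply: ereal_sup_ubound; exists m, n.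
have le2 K m n : evenpos K ->
    ((weighted (@tl1 d K) alpha N rho (AK K) m n)%:E <= seminorm_per alpha N rho AK)%E.
  by move=> eK; apply: ereal_sup_ubound; exists K, m, n.
have sm0 : (0 <= seminorm alpha N rho A)%E.
  by apply: le_trans (le1 0 0); rewrite lee_fin weighted_ge0.
have sp0 : (0 <= seminorm_per alpha N rho AK)%E.
  by apply: le_trans (le2 2%N 0 0 _) => //; rewrite lee_fin weighted_ge0.
split=> [m n|K eK m n]; rewrite -lee_fin (le_trans _ h)//.
  exact: le_trans (le1 m n) (leeDl _ sp0).
exact: le_trans (le2 K m n eK) (leeDr _ sm0).
Qed.

End Seminorms.

Section MatrixAction.
Context {R : realType}.

Lemma Re_le_cabs (z : R[i]) : `|complex.Re z| <= cabs z.
Proof.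
by case: z => u v /=; rewrite -sqrtr_sqr ler_wsqrtr// lerDl sqr_ge0.
Qed.

Lemma Im_le_cabs (z : R[i]) : `|complex.Im z| <= cabs z.
Proof.
by case: z => u v /=; rewrite -sqrtr_sqr ler_wsqrtr// lerDr sqr_ge0.
Qed.

Lemma sum_to_fintype (I : finType) (f : I -> R) : sum_to f (\sum_k f k).
Proof.
move=> e e0; exists [fset k | k in {: I}]%fset => J IJ.
rewrite -(big_fset_incl _ IJ) ?big_imfset//= => [|k _]; last first.
  by move/imfsetP => H; exfalso; apply: H; exists k.
by rewrite big_enum subrr normr0 ltW.
Qed.

Lemma rsum_single (I : choiceType) (f : I -> R) m :
  (forall k, k != m -> f k = 0) -> rsum f = f m.
Proof.
move=> fm; have supp (k : I) : k \notin [fset m]%fset -> f k = 0.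
  by rewrite inE; exact: fm.
have <- : \sum_(k <- [fset m]%fset) f k = f m by rewrite big_seq_fset1.
apply: (sum_to_finite _ supp).
apply: (@sum_to_rsum _ _ _ `|f m|) => J.
apply: (@le_trans _ _ (\sum_(k <- (m |` J)%fset) `|f k|)).
  by apply: ler_sum_subfset => //; exact: fsubsetUr.
rewrite -(big_fset_incl _ (fsubsetUl [fset m]%fset J)) ?big_seq_fset1//.
by move=> k _ /supp ->; rewrite normr0.
Qed.

Lemma mxact_single (I : choiceType) (A : cmat R I) (v : I -> R[i]) m :
  (forall n, n != m -> A m n = 0) -> mxact A v m = A m m * v m.
Proof.
move=> Am; rewrite /mxact /csum !(rsum_single (m := m)).
- by case: (A m m * v m).
- by move=> n /Am ->; rewrite mul0r.
- by move=> n /Am ->; rewrite mul0r.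
Qed.

Lemma mxactK_single (I : finType) (A : cmat R I) (v : I -> R[i]) m :
  (forall n, n != m -> A m n = 0) -> mxactK A v m = A m m * v m.
Proof.
move=> Am; rewrite /mxactK (bigD1 m)//= big1 ?addr0// => n /Am ->.
by rewrite mul0r.
Qed.

Lemma mxact_sum_to (I : choiceType) (A : cmat R I) (v : I -> R[i]) m C :
  (forall J : {fset I}, \sum_(n <- J) cabs (A m n * v n) <= C) ->
  sum_to (fun n => complex.Re (A m n * v n)) (complex.Re (mxact A v m)) /\
  sum_to (fun n => complex.Im (A m n * v n)) (complex.Im (mxact A v m)).
Proof.
move=> AvC; split; apply: (@sum_to_rsum _ _ _ C) => J; apply: le_trans (AvC J);
  by apply: ler_sum => n _; rewrite ?Re_le_cabs ?Im_le_cabs.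
Qed.

Lemma mxactK_sum_to (I : finType) (A : cmat R I) (v : I -> R[i]) m :
  sum_to (fun n => complex.Re (A m n * v n)) (complex.Re (mxactK A v m)) /\
  sum_to (fun n => complex.Im (A m n * v n)) (complex.Im (mxactK A v m)).
Proof.
split.
  rewrite /mxactK (big_morph (@complex.Re R) (id1 := 0) (op1 := +%R)) //;
    last by move=> [? ?] [? ?].
  exact: sum_to_fintype.
rewrite /mxactK (big_morph (@complex.Im R) (id1 := 0) (op1 := +%R)) //;
  last by move=> [? ?] [? ?].
exact: sum_to_fintype.
Qed.

(** Compactness of the interval, used as the possibility of exchanging the local
    eventualities in t with M tending to infinity. *)
Lemma local_to_compact_bound (P : R -> R -> Prop) :
  (forall M M' t, M <= M' -> P M t -> P M' t) ->
  (forall t0 : R, exists M : R, \forall t \near t0, P M t) ->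
  forall T : R, exists M, forall t, `|t| <= T -> P M t.
Proof.
move=> Pmono Ploc T.
have : compact `[- T, T]%classic by exact: segment_compact.
move/compact_near_coveringP => /(_ _ (@pinfty_nbhs R) P) H.
have /H [] : forall t0 : R, `[- T, T]%classic t0 ->
    \forall t \near t0 & M \near +oo, P M t.
  move=> t0 _; have [M MP] := Ploc t0.
  exists ([set t | P M t], [set M' | M < M']) => /=.
    by split=> //; exists M; split=> //; rewrite num_real.
  by move=> [t M'] /= [Pt MM']; apply: Pmono Pt; exact: ltW.
move=> M [_ MP]; exists (M + 1) => t tT; apply: (MP (M + 1)); first by rewrite ltrDl.
by rewrite /= in_itv /= -ler_norml.
Qed.

End MatrixAction.

Section SobolevNorms.
Context {R : realType} {d : nat}.
Implicit Types (v : latt d -> R[i]) (s Y : R) (J : {fset latt d}).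

Lemma hs_norm_le_sqrt s v Y :
  (forall J, \sum_(k <- J) (1 + l1 k)%:R `^ (2 * s) * sqmod (v k) <= Y) ->
  (hs_norm s v <= (Y `^ 2^-1)%:E)%E.
Proof.
move=> vY; rewrite -poweR_EFin /hs_norm.
have E0 : (0 <= \esum_(k in [set: latt d])
    ((1 + l1 k)%:R `^ (2 * s) * cabs (v k) ^+ 2)%:E)%E.
  by apply: esum_ge0 => k _; rewrite lee_fin mulr_ge0 ?powR_ge0 ?exprn_ge0 ?cabs_ge0.
have EY : (\esum_(k in [set: latt d])
    ((1 + l1 k)%:R `^ (2 * s) * cabs (v k) ^+ 2)%:E <= Y%:E)%E.
  by apply: esum_le => J; under eq_bigr do rewrite cabs_sqr.
apply: gt0_ler_poweR (EY) => //.
  by rewrite in_itv /= leey andbT.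
by rewrite in_itv /= leey andbT (le_trans E0 EY).
Qed.

Lemma hs_norm_sqrt s v : (hs_norm s v < +oo)%E -> exists2 Y,
  hs_norm s v = (Y `^ 2^-1)%:E &
  forall J, \sum_(k <- J) (1 + l1 k)%:R `^ (2 * s) * sqmod (v k) <= Y.
Proof.
rewrite /hs_norm; set E := esum _ _ => /lty_poweRy Elty.
have nng k : 0 <= (1 + l1 k)%:R `^ (2 * s) * cabs (v k) ^+ 2.
  by rewrite mulr_ge0 ?powR_ge0 ?exprn_ge0 ?cabs_ge0.
have Efin : E \is a fin_num.
  rewrite ge0_fin_numE ?Elty ?invr_neq0//.
  by rewrite esum_ge0// => k _; rewrite lee_fin.
exists (fine E); first by rewrite -poweR_EFin fineK.
move=> J; under eq_bigr do rewrite -cabs_sqr.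
by rewrite -lee_fin fineK// /E; exact: le_sum_esum.
Qed.

(** The doubling argument starts from an arbitrary bound on a compact time
    interval, which continuity in h^s provides. *)
Lemma solution_locally_bounded s A B (x : R -> latt d -> R[i]) :
  solution s A B x -> forall T : R, exists M0 : R, forall t J, `|t| <= T ->
    \sum_(k <- J) (1 + l1 k)%:R `^ (2 * s) * sqmod (x t k) <= M0.
Proof.
case=> xfin xcont _ T.
pose P (M t : R) := forall J,
  \sum_(k <- J) (1 + l1 k)%:R `^ (2 * s) * sqmod (x t k) <= M.
have [|t0|M MP] := local_to_compact_bound (P := P) _ _ T.
- by move=> M M' t MM' PM J; exact: le_trans (PM J) MM'.
- have [Y _ xY] := hs_norm_sqrt (xfin t0).
  (* Near t0 the distance to x t0 is below 1, and |u+v|^2 <= 2|u|^2 + 2|v|^2. *)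
  exists (2 + 2 * Y); have /fine_cvgP[dfin dcvg] := xcont t0.
  have dlt : \forall t \near t0,
      fine (hs_norm s (fun k => x t k - x t0 k)%R) < 1 := cvgr_lt _ dcvg _ ltr01.
  near=> t => J.
  have : (hs_norm s (fun k => x t k - x t0 k)%R < 1%:E)%E.
    have fin : hs_norm s (fun k => x t k - x t0 k)%R \is a fin_num.
      by near: t; exact: dfin.
    by rewrite -(fineK fin) lte_fin; near: t; exact: dlt.
  move=> d1; have [Z hZ dZ] := hs_norm_sqrt (lt_trans d1 (ltry 1)).
  have Z0 : 0 <= Z by have := dZ fset0; rewrite big_nil.
  have Z1 : Z <= 1.
    move: d1; rewrite hZ lte_fin; apply: contraTT; rewrite -ltNge -leNgt => Z1.
    have : 1 `^ 2^-1 <= Z `^ 2^-1 by rewrite ge0_ler_powR ?nnegrE// ltW.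
    by rewrite powR1.
  apply: (@le_trans _ _ (2 * Z + 2 * Y)); last lra.
  apply: le_trans (lerD (ler_wpM2l _ (dZ J)) (ler_wpM2l _ (xY J))) => //.
  rewrite !mulr_sumr -big_split/=; apply: ler_sum => k _.
  rewrite mulrCA (mulrCA 2) -mulrDr ler_wpM2l ?powR_ge0//.
  by have := sqmodD_le (x t k - x t0 k) (x t0 k); rewrite subrK.
by exists M => t J tT; exact: MP.
Unshelve. all: by end_near.
Qed.

Lemma solutionK_locally_bounded K s A B (y : R -> torus d K -> R[i]) :
  solutionK A B y -> forall T : R, exists M0 : R,
  forall t (J : {fset torus d K}), `|t| <= T ->
    \sum_(k <- J) (1 + tl1 k)%:R `^ (2 * s) * sqmod (y t k) <= M0.
Proof.
move=> ysol T.
pose E t := \sum_k (1 + tl1 k)%:R `^ (2 * s) * sqmod (y t k).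
have [|t0|M MP] := local_to_compact_bound (P := fun M t => E t <= M) _ _ T.
- by move=> M M' t MM' EM; exact: le_trans EM MM'.
- have [c cE] : exists c, is_derive t0 1 E c.
    eexists; apply: is_derive_sum_seq => k; have [dRe dIm] := ysol t0 k.
    exact: is_deriveD (is_deriveX 2 dRe) (is_deriveX 2 dIm).
  have Ecvg : E t @[t --> t0] --> E t0.
    by apply: differentiable_continuous; apply/derivable1_diffP; case: cE.
  exists (E t0 + 1); have Elt : E t0 < E t0 + 1 by rewrite ltrDl.
  apply: filterS (cvgr_lt _ Ecvg _ Elt) => t; exact: ltW.
exists M => t J tT; apply: le_trans (MP t tT).
rewrite /E -sum_fset_fin; apply: ler_sum_subfset.
  by move=> k; rewrite mulr_ge0 ?powR_ge0 ?sqmod_ge0.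
by apply/fsubsetP => k _; apply/imfsetP; exists k.
Qed.

End SobolevNorms.

Section RowSums.
Context {R : realType} {d : nat}.

Lemma cabs_row_le (rho C b : R) (u w q N : nat) : rho < 1 -> 0 <= b ->
  (w <= u + q)%N ->
  b * (1 + q)%:R ^+ N.+1 * (1 + u + w)%:R `^ (- rho) <= C ->
  b <= C * (1 + 2 * u)%:R * (1 + q)%:R ^- N.
Proof.
move=> rho1 b0 wuq bC; set z : R := (1 + u + w)%:R.
have z1 : 1 <= z by rewrite ler1n.
have z0 : 0 < z by rewrite (lt_le_trans ltr01).
have q0 : 0 < (1 + q)%:R :> R by rewrite ltr0n.
have C0 : 0 <= C by apply: le_trans bC; rewrite !mulr_ge0 ?powR_ge0 ?exprn_ge0.
have zrho : z `^ rho <= (1 + 2 * u)%:R * (1 + q)%:R.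
  apply: (@le_trans _ _ z); first by rewrite ler1_powR// ltW.
  by rewrite -natrM ler_nat; move: wuq; clear; nia.
rewrite ler_pdivlMr ?exprn_gt0// -(ler_pM2r q0) -mulrA -exprSr.
apply: (@le_trans _ _ (C * z `^ rho)); last by rewrite -mulrA ler_wpM2l.
by move: bC; rewrite powRN ler_pdivrMr// powR_gt0.
Qed.

(** The coordinates of v are bounded, and against a bounded sequence the rows
    are summable: one of the powers of decay pays for the growth of (1+|m|+|n|)^rho in n. *)
Lemma lattice_row_summable (rho s C : R) (N : nat) (B : cmat R (latt d))
    (v : latt d -> R[i]) m : rho < 1 -> 0 <= s -> (2 * d < N)%N ->
  (forall m n, cabs (B m n) * (1 + l1 (m - n))%:R ^+ N
     * (1 + l1 m + l1 n)%:R `^ (- rho) <= C) ->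
  (hs_norm s v < +oo)%E ->
  exists c, forall J : {fset latt d}, \sum_(n <- J) cabs (B m n * v n) <= c.
Proof.
move=> rho1 s0 dN BC /hs_norm_sqrt[Y _ vY].
have v_le n : cabs (v n) <= 1 + Y.
  have := vY [fset n]%fset; rewrite big_seq_fset1 -cabs_sqr.
  have W1 : 1 <= (1 + l1 n)%:R `^ (2 * s) :> R.
    by rewrite -[leLHS](powRr0 ((1 + l1 n)%:R : R)) ler_powR ?ler1n// mulr_ge0.
  have := ler_peMl (sqr_ge0 (cabs (v n))) W1; have := sqr_ge0 (cabs (v n) - 1).
  nra.
have Y0 : 0 <= 1 + Y := le_trans (cabs_ge0 _) (v_le 0).
exists (C * (1 + 2 * l1 m)%:R * (1 + Y) * 4 ^+ d) => J.
have C0 : 0 <= C.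
  by apply: le_trans (BC m m); rewrite !mulr_ge0 ?powR_ge0 ?exprn_ge0 ?cabs_ge0.
apply: (@le_trans _ _ (\sum_(n <- J) C * (1 + 2 * l1 m)%:R * (1 + Y)
    * (1 + l1 (m - n))%:R ^- (2 * d))); last first.
  by rewrite -mulr_sumr ler_wpM2l ?l1_summable// !mulr_ge0.
apply: ler_sum => n _; rewrite ComplexField.Normc.normcM mulrAC.
rewrite ler_pM ?cabs_ge0//.
apply: (@cabs_row_le rho C (cabs (B m n)) (l1 m) (l1 n) (l1 (m - n)) (2 * d)) => //.
- exact: cabs_ge0.
- by rewrite l1_distC; exact: l1_triangle.
apply: le_trans (BC m n); rewrite ler_wpM2r ?powR_ge0// ler_wpM2l ?cabs_ge0//.
by rewrite ler_weXn2l// ler1n.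
Qed.

End RowSums.

(** The bounds are proved for squared norms; this is their common square root. *)
Lemma growth_sqrt (R : realType) (n : nat) (tau Y s a : R) : 0 <= tau -> 0 <= Y ->
  (2 ^+ n * ((2 * tau) `^ (2 * s / a) * Y)) `^ 2^-1 =
  (2 ^+ n * 2 `^ (2 * s / a)) `^ 2^-1 * tau `^ (s / a) * Y `^ 2^-1.
Proof.
move=> tau0 Y0; rewrite (powRM _ (ler0n _ 2) tau0) !mulrA.
rewrite powRM ?mulr_ge0 ?powR_ge0 ?exprn_ge0// powRM ?mulr_ge0 ?powR_ge0 ?exprn_ge0//.
rewrite -[(tau `^ _) `^ _]powRrM; congr (_ * _ `^ _ * _).
by rewrite mulrAC [2 * s]mulrC mulfK.
Qed.

(** * The growth theorem *)

Theorem theorem4p6 (R : realType) (d : nat) (d_ge1 : (1 <= d)%N)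
    (rho r : R) (rho_lt1 : rho < 1) (rho_lt_r : rho < r)
    (Phi : 'rV[R]_d -> R) (Phi_symbol : symbol_class r Phi)
    (B : R -> cmat R (latt d)) (BK : R -> matfamily R d)
    (B_cont : continuous_A rho B)
    (B_herm : forall t, adjoint (B t) = B t)
    (BK_cont : continuous_Aper rho BK)
    (BK_herm : forall t K, evenpos K -> adjoint (BK t K) = BK t K)
    (B_bound : forall (alpha : latt d) (N : nat), exists C : R, forall t : R,
       (seminorm alpha N rho (B t) + seminorm_per alpha N rho (BK t) <= C%:E)%E) :
  forall s : R, 0 <= s -> exists C : R,
    (forall x : R -> latt d -> R[i], solution s (diagA Phi) B x ->
       forall t : R,
         (hs_norm s (x t)
            <= (C * japanese t `^ (s / (1 - rho)))%:E * hs_norm s (x 0%R))%E) /\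
    (forall K : nat, evenpos K ->
       forall y : R -> torus d K -> R[i],
         solutionK (diagAK Phi (K := K)) (fun t => BK t K) y ->
         forall t : R,
           hs_normK s (y t)
             <= C * japanese t `^ (s / (1 - rho)) * hs_normK s (y 0)).
Proof.
move=> s s0.
pose M := Num.bound (2 * s).
have sM : 2 * s <= M%:R by apply/ltW/archi_boundP; rewrite mulr_ge0.
(* The decay needed: 2d for summability, M >= 2s to compare weights,
   and 2 for the increments of the gauge. *)
pose N := (M + 2 * d).+2.
have [C C_bound] := B_bound 0 N.
have B_le t m n : cabs (B t m n) * (1 + l1 (m - n))%:R ^+ N
    * (1 + l1 m + l1 n)%:R `^ (- rho) <= C.
  by have [h _] := seminorms_le (C_bound t); rewrite -weighted0E.
have BK_le K (eK : evenpos K) t m n : cabs (BK t K m n)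
    * (1 + tl1 (m - n))%:R ^+ N * (1 + tl1 m + tl1 n)%:R `^ (- rho) <= C.
  by have [_ h] := seminorms_le (C_bound t); rewrite -weighted0E; apply: h.
have C0 : 0 <= C.
  by apply: le_trans (B_le 0 0 0); rewrite -weighted0E weighted_ge0.
have S0 : 0 <= 4 ^+ d :> R by rewrite exprn_ge0.
pose b := 4 * (1 - rho + 2 * s) * C * 4 ^+ d.
pose n := (Num.bound b).+1.
have bn : b <= n%:R.
  apply: (@le_trans _ _ (Num.bound b)%:R); last by rewrite ler_nat.
  apply/ltW/archi_boundP; rewrite !mulr_ge0// addr_ge0 ?mulr_ge0//.
  by rewrite subr_ge0 ltW.
have tau0 (t : R) : 0 <= japanese t by exact: sqrtr_ge0.
exists ((2 ^+ n * 2 `^ (2 * s / (1 - rho))) `^ 2^-1); split.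
  move=> x xsol t; have [xfin _ xder] := xsol.
  have [Y ->] := hs_norm_sqrt (xfin 0) => xY.
  have Y0 : 0 <= Y by have := xY fset0; rewrite big_nil.
  rewrite -EFinM -growth_sqrt//; apply: hs_norm_le_sqrt.
  have z_sum u m : exists c, forall J : {fset latt d},
      \sum_(k <- J) cabs (B u m k * x u k) <= c.
    by apply: (lattice_row_summable (N := N) m rho_lt1 s0 _ (B_le u) (xfin u)); lia.
  apply: (evolution_growth (dist := fun m n => l1 (m - n)) (phi := at_latt Phi)
    (z := fun u => mxact (B u) (x u)) l1_distC l1_triangle (l1_summable (R := R))
    _ rho_lt1 s0 sM B_herm B_le _ _ _ S0 C0
    (solution_locally_bounded xsol) t _ bn xY) => //.
  - by move=> L; exists (box L) => k; exact: mem_box.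
  - move=> u m; have := xder u m.
    rewrite [mxact (diagA Phi) _ _]mxact_single /diagA ?eqxx// => k km.
    by rewrite eq_sym (negPf km).
  - by move=> u m; have [c cP] := z_sum u m; have [] := mxact_sum_to cP.
  - by move=> u m; have [c cP] := z_sum u m; have [] := mxact_sum_to cP.
move=> K eK y ysol t.
have norm_sqrt u : hs_normK s (y u) =
    (\sum_k (1 + tl1 k)%:R `^ (2 * s) * sqmod (y u k)) `^ 2^-1.
  rewrite /hs_normK; under eq_bigr do rewrite cabs_sqr.
  by rewrite powR12_sqrt// sumr_ge0// => k _; rewrite mulr_ge0 ?powR_ge0 ?sqmod_ge0.
rewrite !norm_sqrt; set Y := \sum_k _ * sqmod (y 0 k).
have nng u k : 0 <= (1 + tl1 k)%:R `^ (2 * s) * sqmod (y u k).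
  by rewrite mulr_ge0 ?powR_ge0 ?sqmod_ge0.
have Y0 : 0 <= Y by rewrite sumr_ge0.
rewrite -growth_sqrt// ge0_ler_powR ?nnegrE ?sumr_ge0//.
  exact: mulr_ge0 (exprn_ge0 _ (ler0n _ _)) (mulr_ge0 (powR_ge0 _ _) Y0).
rewrite -sum_fset_fin.
apply: (evolution_growth (dist := fun m n => tl1 (m - n))
  (phi := fun k => at_latt Phi (hat k)) (B := fun u => BK u K)
  (z := fun u => mxactK (BK u K) (y u)) (tl1_distC eK) (tl1_triangle eK)
  (tl1_summable (R := R) eK) _ rho_lt1 s0 sM _ (BK_le K eK) _ _ _ S0 C0
  (solutionK_locally_bounded s ysol) t _ bn _) => //.
- by move=> L; exists [fset k | k in {: torus d K}]%fset => k _; apply/imfsetP; exists k.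
- by move=> u; exact: BK_herm.
- move=> u m; have := ysol u m.
  rewrite [mxactK (diagAK Phi (K := K)) _ _]mxactK_single /diagAK ?eqxx// => k km.
  by rewrite eq_sym (negPf km).
- by move=> u m; have [] := mxactK_sum_to (BK u K) (y u) m.
- by move=> u m; have [] := mxactK_sum_to (BK u K) (y u) m.
- move=> J; rewrite /Y -sum_fset_fin; apply: ler_sum_subfset => //.
  by apply/fsubsetP => k _; apply/imfsetP; exists k.
Qed.
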